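(* Let $1\le m\le n$ be integers, let $A_m,\dots,A_n$ be real constants with $A_m^2+\cdots+A_n^2\neq 0$, and let $Y=A_mV_m+\cdots+A_nV_n$ be the corresponding non-trivial linear combination of eigenfunctions of the Sturm-Liouville eigenvalue problem described in the context. Then the function $Y$ has at least $m-1$ and at most $n-1$ zeros in the open interval $(\alpha,\beta)$.
   Context: Let $[\alpha,\beta]\subset(\alpha_0,\beta_0)$ with $\alpha<\beta$, let $K,G,L\in C^\infty((\alpha_0,\beta_0))$ be real-valued with $K,G,L>0$ on $(\alpha_0,\beta_0)$, and let $h,H\in[0,\infty]$. The eigenvalue problem, with spectral parameter $r$, is $$\frac{d}{dx}\Big(K\frac{dV}{dx}\Big)+(rG-L)V=0 \text{ on } (\alpha,\beta),\qquad \Big(K\frac{dV}{dx}-hV\Big)(\alpha)=0,\qquad \Big(K\frac{dV}{dx}+HV\Big)(\beta)=0,$$ where $h=\infty$ (resp. $H=\infty$) means the Dirichlet condition $V(\alpha)=0$ (resp. $V(\beta)=0$). It is known (Sturm) that this problem has an increasing infinite sequence $0<\rho_1<\rho_2<\cdots$ of simple eigenvalues tending to infinity; $V_j$ denotes a real eigenfunction associated with $\rho_j$, and $V_j$ vanishes, and changes sign, exactly $j-1$ times in $(\alpha,\beta)$. Zeros are points of $(\alpha,\beta)$ at which the function vanishes. *)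

(* Defs.v *)
From Stdlib Require Import Reals List.
From Coquelicot Require Import Coquelicot.
Open Scope R_scope.

Definition smooth_on (a b : R) (f : R -> R) : Prop :=
  forall (k : nat) (x : R), a < x < b -> ex_derive_n f k x.

Definition positive_on (a b : R) (f : R -> R) : Prop :=
  forall x : R, a < x < b -> 0 < f x.

(* In the boundary conditions, [v] and [q] stand for the values of V and of
   K dV/dx at the endpoint, and [p_infty] is the Dirichlet condition.  The value
   [m_infty] lies outside the range [0, +oo] of h and H. *)
Definition left_bc (h : Rbar) (v q : R) : Prop :=
  match h with
  | Finite h => q - h * v = 0
  | p_infty => v = 0
  | m_infty => False
  end.

Definition right_bc (H : Rbar) (v q : R) : Prop :=
  match H with
  | Finite H => q + H * v = 0
  | p_infty => v = 0
  | m_infty => False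
  end.

(* Only the values of V on [alpha, beta] matter: [V'] is the derivative of V
   relative to that closed interval, hence one-sided at its endpoints. *)
Definition eigenfunction (alpha beta : R) (K G L : R -> R) (h H : Rbar)
    (r : R) (V : R -> R) : Prop :=
  (exists x, alpha <= x <= beta /\ V x <> 0) /\
  exists V' : R -> R,
    (forall x, alpha <= x <= beta ->
       D_in V V' (fun y => alpha <= y <= beta) x) /\
    (forall x, alpha < x < beta ->
       ex_derive (fun t => K t * V' t) x /\
       Derive (fun t => K t * V' t) x + (r * G x - L x) * V x = 0) /\
    left_bc h (V alpha) (K alpha * V' alpha) /\
    right_bc H (V beta) (K beta * V' beta).

Definition eigenvalue (alpha beta : R) (K G L : R -> R) (h H : Rbar)
    (r : R) : Prop :=
  exists V : R -> R, eigenfunction alpha beta K G L h H r V.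

(* [rho 1 < rho 2 < ...] is the complete list of eigenvalues; [rho 0] is
   irrelevant. *)
Definition eigenvalue_sequence (alpha beta : R) (K G L : R -> R) (h H : Rbar)
    (rho : nat -> R) : Prop :=
  (forall i j : nat, (1 <= i)%nat -> (i < j)%nat -> rho i < rho j) /\
  (forall r : R, eigenvalue alpha beta K G L h H r <->
     exists j : nat, (1 <= j)%nat /\ r = rho j).

(* Main.v *)
Require Import Defs.
From Stdlib Require Import Reals List ZArith Lra Lia Classical IndefiniteDescription.
From Coquelicot Require Import Coquelicot.
Open Scope R_scope.

(** Put k = 1/K, g = G, l = L and let p = K v' be the flux of v; the equation is
    the system v' = k p, p' = - (r g - l) v.  Each boundary condition prescribes
    a direction: (v, p) is parallel to (sin t, cos t), where t = gam lies in
    [0, pi/2] at the left end and t = del in [pi/2, pi] at the right end.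

    Oscillation.  The Pruefer angle of the parameter r is the solution of
    th' = k cos^2 th + (r g - l) sin^2 th with th = gam at the left end; it exists
    by Picard iteration, the right-hand side being Lipschitz in th.  A non-trivial
    solution satisfying the left condition is rad (sin th, cos th) with rad
    nowhere zero ([pruefer_representation]), so r is an eigenvalue exactly when
    th = del + N pi at the right end for a natural number N.  As th' = k > 0
    where th is a multiple of pi, the angle crosses each multiple at most once,
    upward, and N is the number of zeros of the eigenfunction.  The final angle
    is continuous and strictly increasing in r, and at most pi/2 <= del for
    r = 0; by the intermediate value theorem every smaller N belongs to a smaller
    eigenvalue.  Hence, numbering from 0, the j-th eigenvalue has N = j
    ([eigenvalue_index]).

    Sturm's step.  If y = sum_j B_j v_j, then w = sum_j (rho_j - rho_0) B_j v_j
    has at least as many zeros as y.  With q the flux of y, consider the Wronskian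
    W = q v_0 - y p_0.  Since (y / v_0)' = k W / v_0^2, Rolle's theorem gives a zero
    of W between consecutive zeros of y; the boundary conditions give two more,
    at the end points; and W' = - g w v_0, so Rolle's theorem gives a zero of w
    between consecutive zeros of W ([sturm_step]).

    Both bounds follow by iterating this step T times, which multiplies the
    coefficients by (rho_j - rho_0)^T.  For large T the result is, up to a factor,
    close to the mode v_q of the last non-zero coefficient, and a combination
    close to v_q has at most q zeros, one for each multiple of pi crossed by the
    angle of v_q ([nearby_few_zeros]); this bounds the number of zeros of y from
    above ([zeros_at_most]).  Conversely, dividing the coefficients by
    (rho_j - rho_0)^T gives a combination close to the mode v_q of the first
    non-zero coefficient, which has at least q zeros because v_q changes sign q
    times ([nearby_has_zeros]); T steps lead from it to y
    ([zeros_at_least]). *)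

(** * Calculus on an interval *)

(** The intermediate point is interior, which the zero counts by Rolle's theorem
    rely on. *)
Lemma mvt_open (f df : R -> R) (a b : R) :
  a < b ->
  (forall x, a < x < b -> is_derive f x (df x)) ->
  (forall x, a <= x <= b -> continuity_pt f x) ->
  exists c, a < c < b /\ f b - f a = df c * (b - a).
Proof.
  intros Hab Hd Hc.
  set (s := (f b - f a) / (b - a)).
  set (F := fun x => f x - s * x).
  assert (HdF : forall x, a < x < b -> is_derive F x (df x - s)).
  { intros x Hx. unfold F.
    evar_last.
    { apply @is_derive_minus; [apply (Hd x Hx) | apply is_derive_scal, is_derive_id]. }
    unfold minus, plus, opp, one; simpl; ring. }
  assert (pr : forall x, a < x < b -> derivable_pt F x).
  { intros x Hx. exists (df x - s). apply is_derive_Reals, HdF, Hx. }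
  destruct (Rolle F a b pr) as (c & P & Hcz).
  - intros x Hx. unfold F. apply continuity_pt_minus; [now apply Hc|].
    apply continuity_pt_mult; [apply continuity_pt_const; now intros ? ?|].
    apply derivable_continuous_pt, derivable_pt_id.
  - exact Hab.
  - unfold F, s. field. lra.
  - exists c. split; [exact P|].
    assert (E : derive_pt F c (pr c P) = df c - s).
    { apply derive_pt_eq_0, is_derive_Reals, HdF, P. }
    rewrite E in Hcz. replace (df c) with s by lra. unfold s. field. lra.
Qed.

Lemma mvt_between (f df : R -> R) (x z : R) :
  x <> z ->
  (forall t, Rmin x z < t < Rmax x z -> is_derive f t (df t)) ->
  (forall t, Rmin x z <= t <= Rmax x z -> continuity_pt f t) ->
  exists c, Rmin x z < c < Rmax x z /\ (f z - f x) / (z - x) = df c.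
Proof.
  intros Hxz Hd Hc. destruct (Rlt_le_dec x z) as [Hlt|Hle].
  - rewrite Rmin_left, Rmax_right in * by lra.
    destruct (mvt_open f df x z Hlt Hd Hc) as (c & Hcx & E).
    exists c. split; [exact Hcx|]. rewrite E. field. lra.
  - rewrite Rmin_right, Rmax_left in * by lra.
    destruct (mvt_open f df z x ltac:(lra) Hd Hc) as (c & Hcx & E).
    exists c. split; [exact Hcx|].
    replace (f z - f x) with (df c * (z - x)) by lra. field. lra.
Qed.

Lemma rolle_zero (f df : R -> R) (x y : R) :
  x < y ->
  (forall t, x < t < y -> is_derive f t (df t)) ->
  (forall t, x <= t <= y -> continuity_pt f t) ->
  f x = 0 -> f y = 0 -> exists t, x < t < y /\ df t = 0.
Proof.
  intros Hxy Hd Hc Hx Hy.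
  destruct (mvt_open f df x y Hxy Hd Hc) as (t & Ht & E).
  exists t. split; [exact Ht|]. rewrite Hx, Hy, Rminus_diag in E.
  symmetry in E. apply Rmult_integral in E as [E|E]; [exact E|lra].
Qed.

Lemma nondecreasing_of_derive (f df : R -> R) (a b : R) :
  a <= b ->
  (forall x, a < x < b -> is_derive f x (df x) /\ 0 <= df x) ->
  (forall x, a <= x <= b -> continuity_pt f x) ->
  f a <= f b.
Proof.
  intros [Hab | ->] Hd Hc; [|lra].
  destruct (mvt_open f df a b Hab) as (c & Hcab & E); auto.
  - intros x Hx. apply Hd, Hx.
  - destruct (Hd c Hcab) as [_ Hp]. nra.
Qed.

Lemma derive_eq_on_interval (f h : R -> R) (df dh a b x : R) :
  a < x < b -> (forall t, a < t < b -> f t = h t) ->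
  is_derive f x df -> is_derive h x dh -> df = dh.
Proof.
  intros Hx Heq Df Dh. apply (is_derive_ext_loc f h) in Df.
  - rewrite <- (is_derive_unique _ _ _ Df). now apply is_derive_unique.
  - apply (locally_interval _ x a b); simpl; try lra. intros y Ha Hb. now apply Heq.
Qed.

Lemma continuity_pt_eps (f : R -> R) (x : R) :
  continuity_pt f x ->
  forall eps, 0 < eps ->
  exists d, 0 < d /\ forall y, Rabs (y - x) < d -> Rabs (f y - f x) < eps.
Proof.
  intros Hf eps He.
  apply continuity_pt_filterlim in Hf.
  destruct (proj1 (filterlim_locally f (f x)) Hf (mkposreal eps He)) as [d Hd].
  exists d. split; [apply cond_pos|]. intros y Hy. apply Hd, Hy.
Qed.

Lemma continuity_pt_of_eps (f : R -> R) (x : R) :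
  (forall eps, 0 < eps ->
    exists d, 0 < d /\ forall y, Rabs (y - x) < d -> Rabs (f y - f x) < eps) ->
  continuity_pt f x.
Proof.
  intros Hf. apply continuity_pt_filterlim, filterlim_locally.
  intros eps. destruct (Hf eps (cond_pos eps)) as (d & Hd & Hy).
  exists (mkposreal d Hd). intros y Hb. apply Hy, Hb.
Qed.

Lemma is_derive_continuity_pt (f : R -> R) (x l : R) :
  is_derive f x l -> continuity_pt f x.
Proof.
  intros H. apply continuity_pt_filterlim.
  apply (ex_derive_continuous f x). now exists l.
Qed.

Lemma bounded_derive_lipschitz (f df : R -> R) (M : R) :
  (forall x, is_derive f x (df x)) -> (forall x, Rabs (df x) <= M) ->
  forall y z, Rabs (f y - f z) <= M * Rabs (y - z).
Proof.
  intros Hd Hb y z.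
  destruct (MVT_gen f z y df) as (c & _ & E).
  - intros; apply Hd.
  - intros; eapply is_derive_continuity_pt, Hd.
  - rewrite E, Rabs_mult. apply Rmult_le_compat_r; [apply Rabs_pos|apply Hb].
Qed.

(** The integrating factor behind the Gronwall type estimates below. *)
Lemma weighted_derive (d dd : R -> R) (M x : R) :
  is_derive d x (dd x) ->
  is_derive (fun t => exp (- M * t) * d t) x (exp (- M * x) * (dd x - M * d x)).
Proof.
  intros H. evar_last.
  { apply (is_derive_mult (fun t => exp (- M * t)) d x (- M * exp (- M * x)) (dd x)).
    - auto_derive; auto. ring.
    - exact H.
    - intros; apply Rmult_comm. }
  unfold plus, mult; simpl; ring.
Qed.

Lemma continuity_pt_weighted (d : R -> R) (M x : R) :
  continuity_pt d x -> continuity_pt (fun t => exp (- M * t) * d t) x.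
Proof.
  intros H. apply continuity_pt_mult; [|exact H].
  apply (is_derive_continuity_pt _ _ (- M * exp (- M * x))).
  auto_derive; auto. ring.
Qed.

(** Let s be the last point at which d is nonnegative.  As long as d stays in
    ]-eps, 0[ after s, the function exp (- M x) d is nondecreasing from a nonnegative
    value, so d cannot be negative.  The inequality is only required for small
    negative d because it will be known only when an angle is close to a level. *)
Lemma nonneg_propagates (d dd : R -> R) (a b eps M : R) :
  a <= b -> 0 < eps ->
  (forall x, a <= x <= b -> continuity_pt d x) ->
  (forall x, a < x < b -> is_derive d x (dd x)) ->
  (forall x, a < x < b -> - eps < d x < 0 -> M * d x <= dd x) ->
  0 <= d a -> 0 <= d b.
Proof.
  intros Hab He Hc Hd HM Ha.
  destruct (Rle_lt_dec 0 (d b)) as [|Hb]; [assumption|exfalso].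
  set (E := fun x => a <= x <= b /\ 0 <= d x).
  destruct (completeness E) as [s [Hub Hlub]].
  { exists b. intros x [Hx _]. apply Hx. }
  { exists a. split; [lra|exact Ha]. }
  assert (Has : a <= s). { apply Hub. split; [lra|exact Ha]. }
  assert (Hsb : s <= b). { apply Hlub. intros x [Hx _]. apply Hx. }
  assert (Hneg : forall x, s < x <= b -> d x < 0).
  { intros x Hx. destruct (Rle_lt_dec 0 (d x)) as [Hp|]; [|assumption].
    enough (x <= s) by lra. apply Hub. split; [lra|exact Hp]. }
  assert (Hs0 : 0 <= d s).
  { destruct (Rle_lt_dec 0 (d s)) as [|Hs]; [assumption|exfalso].
    destruct (continuity_pt_eps d s (Hc s (conj Has Hsb)) (- d s)) as (e & He0 & Hcl); [lra|].
    enough (s <= s - e) by lra.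
    apply Hlub. intros x [Hx Hdx].
    destruct (Rle_lt_dec x (s - e)) as [|Hlt]; [assumption|exfalso].
    assert (x <= s) by (apply Hub; split; assumption).
    assert (Hcx : Rabs (d x - d s) < - d s) by (apply Hcl, Rabs_def1; lra).
    apply Rabs_def2 in Hcx. lra. }
  assert (Hsb' : s < b). { destruct Hsb as [|Heq]; [assumption|]. rewrite Heq in Hs0. lra. }
  destruct (continuity_pt_eps d s (Hc s (conj Has Hsb)) eps He) as (e & He0 & Hcl).
  set (b' := Rmin b (s + e / 2)).
  assert (Hb1 : b' <= b) by apply Rmin_l.
  assert (Hb2 : b' <= s + e / 2) by apply Rmin_r.
  assert (Hb3 : s < b') by (apply Rmin_glb_lt; lra).
  assert (Hle : exp (- M * s) * d s <= exp (- M * b') * d b').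
  { apply (nondecreasing_of_derive (fun x => exp (- M * x) * d x)
             (fun x => exp (- M * x) * (dd x - M * d x))); [lra| |].
    - intros x Hx. split.
      + apply weighted_derive, Hd. lra.
      + apply Rmult_le_pos; [apply Rlt_le, exp_pos|].
        assert (Hcx : Rabs (d x - d s) < eps) by (apply Hcl, Rabs_def1; lra).
        apply Rabs_def2 in Hcx.
        assert (d x < 0) by (apply Hneg; lra).
        assert (M * d x <= dd x) by (apply HM; lra). lra.
    - intros x Hx. apply continuity_pt_weighted, Hc. lra. }
  assert (Hdb' : d b' < 0) by (apply Hneg; lra).
  assert (P1 := exp_pos (- M * s)). assert (P2 := exp_pos (- M * b')). nra.
Qed.

(** The function exp (2 M x) w^2 is nondecreasing and exp (- 2 M x) w^2 is
    nonincreasing, so a zero of w propagates to the left and to the right. *)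
Lemma linear_growth_zero (w dw : R -> R) (a b M x0 : R) :
  (forall x, a <= x <= b -> continuity_pt w x) ->
  (forall x, a < x < b -> is_derive w x (dw x) /\ Rabs (dw x) <= M * Rabs (w x)) ->
  a <= x0 <= b -> w x0 = 0 ->
  forall x, a <= x <= b -> w x = 0.
Proof.
  intros Hc Hd Hx0 Hw0 x Hx.
  assert (Hd2 : forall t, a < t < b -> is_derive (fun y => w y * w y) t (2 * (w t * dw t))).
  { intros t Ht. evar_last.
    - apply @is_derive_mult; [apply Hd, Ht|apply Hd, Ht|intros; apply Rmult_comm].
    - unfold plus, mult; simpl; ring. }
  assert (Hb2 : forall t, a < t < b -> Rabs (w t * dw t) <= M * (w t * w t)).
  { intros t Ht. rewrite Rabs_mult. destruct (Hd t Ht) as [_ Hm].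
    assert (E : w t * w t = Rabs (w t) * Rabs (w t)) by (rewrite <- Rabs_mult, Rabs_pos_eq; nra).
    rewrite E. assert (P := Rabs_pos (w t)). nra. }
  assert (Hc2 : forall t, a <= t <= b -> continuity_pt (fun y => w y * w y) t).
  { intros t Ht. apply continuity_pt_mult; now apply Hc. }
  assert (Hsq : w x * w x <= 0).
  { destruct (Rle_lt_dec x x0) as [Hl|Hl].
    - assert (E : exp (- (-(2 * M)) * x) * (w x * w x) <= exp (- (-(2 * M)) * x0) * (w x0 * w x0)).
      { apply (nondecreasing_of_derive (fun y => exp (- (-(2 * M)) * y) * (w y * w y))
                 (fun y => exp (- (-(2 * M)) * y) *
                    (2 * (w y * dw y) - (-(2 * M)) * (w y * w y)))); auto.
        - intros t Ht. split.
          + apply (weighted_derive (fun y => w y * w y) (fun y => 2 * (w y * dw y))).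
            apply Hd2. lra.
          + apply Rmult_le_pos; [apply Rlt_le, exp_pos|].
            assert (Ht' : a < t < b) by lra.
            specialize (Hb2 t Ht'). apply Rabs_le_between in Hb2. lra.
        - intros t Ht. apply (continuity_pt_weighted (fun y => w y * w y)), Hc2. lra. }
      rewrite Hw0 in E. assert (P := exp_pos (- (-(2 * M)) * x)). nra.
    - assert (E : exp (- (2 * M) * x0) * (- (w x0 * w x0))
                  <= exp (- (2 * M) * x) * (- (w x * w x))).
      { apply (nondecreasing_of_derive (fun y => exp (- (2 * M) * y) * (- (w y * w y)))
                 (fun y => exp (- (2 * M) * y) *
                    (- (2 * (w y * dw y)) - (2 * M) * (- (w y * w y))))).
        - lra.
        - intros t Ht. split.
          + apply (weighted_derive (fun y => - (w y * w y)) (fun y => - (2 * (w y * dw y)))).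
            apply @is_derive_opp, Hd2. lra.
          + apply Rmult_le_pos; [apply Rlt_le, exp_pos|].
            assert (Ht' : a < t < b) by lra.
            specialize (Hb2 t Ht'). apply Rabs_le_between in Hb2. lra.
        - intros t Ht. apply (continuity_pt_weighted (fun y => - (w y * w y))).
          apply continuity_pt_opp, Hc2. lra. }
      rewrite Hw0 in E. assert (P := exp_pos (- (2 * M) * x)). nra. }
  nra.
Qed.

Lemma continuity_sin_comp (f : R -> R) : continuity f -> continuity (fun t => sin (f t)).
Proof. intros Hf x. apply (continuity_pt_comp f sin); [apply Hf|apply continuity_sin]. Qed.

Lemma continuity_cos_comp (f : R -> R) : continuity f -> continuity (fun t => cos (f t)).
Proof. intros Hf x. apply (continuity_pt_comp f cos); [apply Hf|apply continuity_cos]. Qed.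

Lemma is_derive_sin_comp (f : R -> R) (x d : R) :
  is_derive f x d -> is_derive (fun t => sin (f t)) x (d * cos (f x)).
Proof.
  intros Hf. apply (is_derive_comp sin f x (cos (f x)) d); [|exact Hf].
  auto_derive; auto. ring.
Qed.

Lemma is_derive_cos_comp (f : R -> R) (x d : R) :
  is_derive f x d -> is_derive (fun t => cos (f t)) x (d * - sin (f x)).
Proof.
  intros Hf. apply (is_derive_comp cos f x (- sin (f x)) d); [|exact Hf].
  auto_derive; auto. ring.
Qed.

(** * Extension by constants *)

(** Composing with this retraction onto [a, b] turns functions that are continuous
    on [a, b] into functions continuous on the whole line. *)
Definition clamp (a b x : R) : R := Rmax a (Rmin b x).

Lemma clamp_id (a b x : R) : a <= x <= b -> clamp a b x = x.
Proof. intros. unfold clamp. rewrite Rmin_right, Rmax_right; lra. Qed.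

Lemma clamp_in (a b x : R) : a <= b -> a <= clamp a b x <= b.
Proof.
  intros. unfold clamp, Rmax, Rmin.
  destruct (Rle_dec b x); destruct (Rle_dec a _); lra.
Qed.

Lemma clamp_lipschitz (a b x y : R) :
  a <= b -> Rabs (clamp a b x - clamp a b y) <= Rabs (x - y).
Proof.
  intros. unfold clamp, Rmax, Rmin.
  destruct (Rle_dec b x); destruct (Rle_dec b y);
    repeat match goal with |- context [Rle_dec ?u ?v] => destruct (Rle_dec u v) end;
    unfold Rabs; repeat destruct (Rcase_abs _); lra.
Qed.

Lemma continuity_clamp (a b : R) (f : R -> R) :
  a <= b -> (forall x, a <= x <= b -> continuity_pt f x) ->
  continuity (fun x => f (clamp a b x)).
Proof.
  intros Hab Hf x. apply continuity_pt_of_eps. intros eps He.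
  destruct (continuity_pt_eps f _ (Hf _ (clamp_in a b x Hab)) eps He) as (d & Hd & Hy).
  exists d. split; [exact Hd|]. intros y Hyx. apply Hy.
  eapply Rle_lt_trans; [now apply clamp_lipschitz|exact Hyx].
Qed.

Lemma lipschitz_clamp_continuity (f : R -> R) (a b M : R) :
  a <= b -> 0 <= M ->
  (forall x y, a <= x <= b -> a <= y <= b -> Rabs (f x - f y) <= M * Rabs (x - y)) ->
  continuity (fun x => f (clamp a b x)).
Proof.
  intros Hab HM Hf x. apply continuity_pt_of_eps. intros eps He.
  exists (eps / (M + 1)). split; [apply Rdiv_lt_0_compat; lra|]. intros y Hy.
  assert (A := Hf _ _ (clamp_in a b y Hab) (clamp_in a b x Hab)).
  assert (B := clamp_lipschitz a b y x Hab).
  assert (P := Rabs_pos (clamp a b y - clamp a b x)).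
  apply (Rmult_lt_compat_l (M + 1)) in Hy; [|lra].
  replace ((M + 1) * (eps / (M + 1))) with eps in Hy by (field; lra).
  assert (M * Rabs (clamp a b y - clamp a b x) <= M * Rabs (y - x))
    by (apply Rmult_le_compat_l; lra).
  assert (Q := Rabs_pos (y - x)). lra.
Qed.

Lemma locally_clamp_id (a b x : R) :
  a < x < b -> locally x (fun y => clamp a b y = y).
Proof.
  intros Hx.
  assert (Hd : 0 < Rmin (x - a) (b - x)) by (apply Rmin_glb_lt; lra).
  exists (mkposreal _ Hd). intros y Hy.
  assert (Hy' : Rabs (y - x) < Rmin (x - a) (b - x)) by exact Hy.
  apply Rabs_def2 in Hy'.
  assert (A1 := Rmin_l (x - a) (b - x)). assert (A2 := Rmin_r (x - a) (b - x)).
  apply clamp_id. lra.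
Qed.

Lemma is_derive_clamp (f : R -> R) (a b x d : R) :
  a < x < b -> is_derive f x d -> is_derive (fun y => f (clamp a b y)) x d.
Proof.
  intros Hx. apply is_derive_ext_loc.
  apply (filter_imp (fun y => clamp a b y = y)); [|now apply locally_clamp_id].
  intros y Hy. now rewrite Hy.
Qed.

(** * Sine and cosine near the multiples of pi *)

Lemma sin_cos_sqr (x : R) : sin x * sin x + cos x * cos x = 1.
Proof. exact (sin2_cos2 x). Qed.

Lemma Rabs_sin_cos (x : R) : Rabs (sin x * cos x) <= 1.
Proof.
  assert (E := sin_cos_sqr x).
  assert (0 <= (sin x + cos x) * (sin x + cos x)) by apply Rle_0_sqr.
  assert (0 <= (sin x - cos x) * (sin x - cos x)) by apply Rle_0_sqr.
  apply Rabs_le_between. lra.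
Qed.

Lemma sin_level (j : Z) : sin (IZR j * PI) = 0.
Proof. apply sin_eq_0_1. now exists j. Qed.

Lemma cos_level_sqr (j : Z) : cos (IZR j * PI) * cos (IZR j * PI) = 1.
Proof.
  assert (T := sin_cos_sqr (IZR j * PI)). rewrite sin_level in T. lra.
Qed.

Lemma Rabs_cos_level (j : Z) : Rabs (cos (IZR j * PI)) = 1.
Proof.
  assert (Q := cos_level_sqr j). rewrite <- Rabs_R1. apply Rsqr_eq_abs_0.
  unfold Rsqr. lra.
Qed.

Lemma sin_shift_level (y : R) (j : Z) : sin y = cos (IZR j * PI) * sin (y - IZR j * PI).
Proof.
  replace y with ((y - IZR j * PI) + IZR j * PI) at 1 by ring.
  rewrite sin_plus, sin_level. ring.
Qed.

Lemma cos_shift_level (y : R) (j : Z) : cos y = cos (IZR j * PI) * cos (y - IZR j * PI).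
Proof.
  replace y with ((y - IZR j * PI) + IZR j * PI) at 1 by ring.
  rewrite cos_plus, sin_level. ring.
Qed.

(** The nearest integer to y / PI: levels are the multiples of PI, the angles at
    which an eigenfunction vanishes. *)
Definition level (y : R) : Z := (up (y / PI + / 2) - 1)%Z.

Lemma level_near (y : R) : - (PI / 2) <= y - IZR (level y) * PI <= PI / 2.
Proof.
  assert (HP := PI_RGT_0). unfold level. rewrite minus_IZR.
  destruct (archimed (y / PI + / 2)) as [A B].
  set (u := IZR (up (y / PI + / 2))) in *.
  apply (Rmult_lt_compat_r PI) in A; [|exact HP].
  apply (Rmult_le_compat_r PI) in B; [|lra].
  replace ((y / PI + / 2) * PI) with (y + PI / 2) in A by (field; lra).
  replace ((u - (y / PI + / 2)) * PI) with (u * PI - (y + PI / 2)) in B by (field; lra).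
  lra.
Qed.

Lemma small_sin_near_level (y eta : R) :
  0 < eta <= PI / 2 -> Rabs (sin y) < sin eta ->
  Rabs (y - IZR (level y) * PI) < eta.
Proof.
  intros He Hs. assert (Hn := level_near y).
  rewrite (sin_shift_level y (level y)), Rabs_mult in Hs.
  rewrite Rabs_cos_level, Rmult_1_l in Hs. apply Rabs_def2 in Hs.
  set (s := y - IZR (level y) * PI) in *.
  apply Rabs_def1.
  - destruct (Rlt_le_dec s eta) as [|Hge]; [assumption|exfalso].
    assert (A : sin eta <= sin s) by (apply sin_incr_1; lra). lra.
  - destruct (Rlt_le_dec (- eta) s) as [|Hge]; [assumption|exfalso].
    assert (A : sin s <= sin (- eta)) by (apply sin_incr_1; lra).
    rewrite sin_neg in A. lra.
Qed.

Lemma sin_cos_atan (h : R) : 0 < cos (atan h) /\ sin (atan h) = h * cos (atan h).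
Proof.
  assert (A := atan_bound h).
  assert (Hc : 0 < cos (atan h)) by (apply cos_gt_0; lra).
  split; [exact Hc|]. rewrite <- (tan_atan h) at 2. unfold tan. field. lra.
Qed.

(** * Finite families *)

Lemma finite_choice (P : nat -> R -> Prop) (n : nat) :
  (forall i, (i < n)%nat -> exists x, P i x) ->
  exists f : nat -> R, forall i, (i < n)%nat -> P i (f i).
Proof.
  induction n as [|n IH]; intros HP.
  - exists (fun _ => 0). intros i Hi. lia.
  - destruct IH as [f Hf]; [intros i Hi; apply HP; lia|].
    destruct (HP n ltac:(lia)) as [x Hx].
    exists (fun i => if Nat.eq_dec i n then x else f i).
    intros i Hi. destruct (Nat.eq_dec i n) as [->|]; [exact Hx|apply Hf; lia].
Qed.

Lemma finite_pos_bound (f : nat -> R) (n : nat) :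
  (forall i, (i < n)%nat -> 0 < f i) ->
  exists mu, 0 < mu /\ forall i, (i < n)%nat -> mu <= f i.
Proof.
  induction n as [|n IH]; intros Hf.
  - exists 1. split; [lra|]. intros i Hi. lia.
  - destruct IH as (mu & Hmu & Hle); [intros i Hi; apply Hf; lia|].
    exists (Rmin mu (f n)). split.
    + apply Rmin_glb_lt; [exact Hmu|apply Hf; lia].
    + intros i Hi. destruct (Nat.eq_dec i n) as [->|]; [apply Rmin_r|].
      eapply Rle_trans; [apply Rmin_l|apply Hle; lia].
Qed.

Lemma first_nonzero (A : nat -> R) (N : nat) :
  (exists j, (j < N)%nat /\ A j <> 0) ->
  exists q, (q < N)%nat /\ A q <> 0 /\ forall j, (j < q)%nat -> A j = 0.
Proof.
  intros (j & Hj & HA). induction j as [j IH] using lt_wf_ind.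
  destruct (classic (exists i, (i < j)%nat /\ A i <> 0)) as [(i & Hi & HAi)|Hno].
  - apply (IH i Hi); [lia|exact HAi].
  - exists j. split; [exact Hj|]. split; [exact HA|]. intros i Hi.
    apply NNPP. intros Hne. apply Hno. now exists i.
Qed.

Lemma last_nonzero (A : nat -> R) (N : nat) :
  (exists j, (j < N)%nat /\ A j <> 0) ->
  exists q, (q < N)%nat /\ A q <> 0 /\ forall j, (q < j)%nat -> (j < N)%nat -> A j = 0.
Proof.
  induction N as [|N IH]; intros (j & Hj & HA); [lia|].
  destruct (Req_dec (A N) 0) as [HN|HN].
  - destruct IH as (q & Hq & HAq & Hl).
    { exists j. split; [|exact HA]. destruct (Nat.eq_dec j N) as [->|]; [contradiction|lia]. }
    exists q. split; [lia|]. split; [exact HAq|]. intros i Hi Hi'.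
    destruct (Nat.eq_dec i N) as [->|]; [exact HN|apply Hl; lia].
  - exists N. split; [lia|]. split; [exact HN|]. intros i Hi Hi'. lia.
Qed.

(** Rolle's theorem needs zeros in increasing order; the maximum of the list is
    placed last. *)
Lemma sorted_enumeration (L : list R) :
  NoDup L ->
  exists x : nat -> R,
    (forall i, (i < length L)%nat -> In (x i) L) /\
    (forall i, (S i < length L)%nat -> x i < x (S i)).
Proof.
  remember (length L) as N eqn:HN. revert L HN.
  induction N as [|N IH]; intros L HN HL.
  { exists (fun _ => 0). split; intros i Hi; lia. }
  assert (Hmax : exists z, In z L /\ forall y, In y L -> y <= z).
  { clear IH HL. destruct L as [|u L]; [discriminate|clear HN]. revert u.
    induction L as [|u' L IHL]; intros u.
    - exists u. split; [now left|]. intros y [<-|[]]. lra.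
    - destruct (IHL u') as (z & Hz & Hle).
      destruct (Rle_lt_dec u z) as [Huz|Huz].
      + exists z. split; [now right|]. intros y [<-|Hy]; [exact Huz|now apply Hle].
      + exists u. split; [now left|]. intros y [<-|Hy]; [lra|].
        specialize (Hle y Hy). lra. }
  destruct Hmax as (z & Hz & Hle).
  destruct (in_split z L Hz) as (L1 & L2 & ->).
  assert (Hlen : length (L1 ++ z :: L2) = S (length (L1 ++ L2)))
    by (rewrite !length_app; simpl; lia).
  destruct (IH (L1 ++ L2)) as (x & Hx & Hord); [lia|now apply NoDup_remove_1 in HL|].
  assert (Hnz := NoDup_remove_2 _ _ _ HL).
  assert (Hin : forall y, In y (L1 ++ L2) -> In y (L1 ++ z :: L2)).
  { intros y Hy. apply in_app_iff in Hy. apply in_app_iff. simpl. tauto. }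
  exists (fun i => if Nat.eq_dec i N then z else x i). split.
  - intros i Hi. destruct (Nat.eq_dec i N); [exact Hz|]. apply Hin, Hx. lia.
  - intros i Hi. destruct (Nat.eq_dec i N); [lia|].
    destruct (Nat.eq_dec (S i) N) as [|]; [|apply Hord; lia].
    assert (A := Hx i ltac:(lia)). destruct (Hle (x i) (Hin _ A)) as [|E]; [assumption|].
    rewrite E in A. contradiction.
Qed.

Lemma pow_div_distr (x y : R) (n : nat) : (x / y) ^ n = x ^ n / y ^ n.
Proof. unfold Rdiv. now rewrite Rpow_mult_distr, pow_inv. Qed.

Lemma small_geometric (D eps : R) : 0 < eps -> exists n, D / 2 ^ n < eps.
Proof.
  intros He.
  destruct (pow_lt_1_zero (/ 2)) with (y := eps / (Rabs D + 1)) as [N HN].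
  - rewrite Rabs_pos_eq; lra.
  - assert (A := Rabs_pos D). apply Rdiv_lt_0_compat; lra.
  - exists N. specialize (HN N (le_n _)).
    assert (A := Rabs_pos D). assert (A' := Rle_abs D).
    rewrite Rabs_pos_eq in HN by (apply pow_le; lra).
    rewrite pow_inv in HN. unfold Rdiv.
    apply (Rmult_lt_compat_l (Rabs D + 1)) in HN; [|lra].
    replace ((Rabs D + 1) * (eps / (Rabs D + 1))) with eps in HN by (field; lra).
    assert (P : 0 < / 2 ^ N) by (apply Rinv_0_lt_compat, pow_lt; lra). nra.
Qed.

(** The alternative s j = 0 covers the indices whose ratio t j is out of control. *)
Lemma powers_vanish (t s : nat -> R) (N : nat) (e : R) :
  0 < e -> (forall j, (j < N)%nat -> s j = 0 \/ Rabs (t j) < 1) ->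
  exists T0, forall T, (T0 <= T)%nat ->
    forall j, (j < N)%nat -> Rabs (t j ^ T * s j) <= e.
Proof.
  intros He. induction N as [|N IH]; intros H.
  - exists 0%nat. intros T _ j Hj. lia.
  - destruct IH as (T1 & H1); [intros j Hj; apply H; lia|].
    assert (HN : exists T2, forall T, (T2 <= T)%nat -> Rabs (t N ^ T * s N) <= e).
    { destruct (H N (Nat.lt_succ_diag_r N)) as [E|E].
      - exists 0%nat. intros T _. rewrite E, Rmult_0_r, Rabs_R0. lra.
      - destruct (pow_lt_1_zero (t N) E (e / (Rabs (s N) + 1))) as (T2 & HT2).
        + assert (A := Rabs_pos (s N)). apply Rdiv_lt_0_compat; lra.
        + exists T2. intros T HT. specialize (HT2 T HT). rewrite Rabs_mult.
          assert (A := Rabs_pos (s N)). assert (A' := Rabs_pos (t N ^ T)).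
          apply (Rmult_lt_compat_r (Rabs (s N) + 1)) in HT2; [|lra].
          replace (e / (Rabs (s N) + 1) * (Rabs (s N) + 1)) with e in HT2 by (field; lra).
          nra. }
    destruct HN as (T2 & H2). exists (T1 + T2)%nat. intros T HT j Hj.
    destruct (Nat.eq_dec j N) as [->|]; [apply H2; lia|apply H1; lia].
Qed.

(** * Linear combinations of functions *)

Fixpoint comb (B : nat -> R) (f : nat -> R -> R) (N : nat) (x : R) : R :=
  match N with
  | O => 0
  | S N => comb B f N x + B N * f N x
  end.

Lemma comb_ext (B B' : nat -> R) (f : nat -> R -> R) (N : nat) (x : R) :
  (forall j, (j < N)%nat -> B j = B' j) -> comb B f N x = comb B' f N x.
Proof.
  induction N as [|N IH]; intros H; [reflexivity|]. simpl.
  rewrite IH, (H N); [reflexivity|lia|]. intros j Hj. apply H. lia.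
Qed.

Lemma comb_scale (s : R) (B : nat -> R) (f : nat -> R -> R) (N : nat) (x : R) :
  comb (fun j => s * B j) f N x = s * comb B f N x.
Proof. induction N as [|N IH]; simpl; [ring|]. rewrite IH. ring. Qed.

Lemma comb_minus (B B' : nat -> R) (f : nat -> R -> R) (N : nat) (x : R) :
  comb (fun j => B j - B' j) f N x = comb B f N x - comb B' f N x.
Proof. induction N as [|N IH]; simpl; [ring|]. rewrite IH. ring. Qed.

Definition delta (q j : nat) : R := if Nat.eq_dec j q then 1 else 0.

Lemma comb_delta (q : nat) (f : nat -> R -> R) (N : nat) (x : R) :
  comb (delta q) f N x = if Nat.ltb q N then f q x else 0.
Proof.
  induction N as [|N IH]; simpl; [reflexivity|]. rewrite IH. unfold delta.
  destruct (Nat.eq_dec N q) as [->|Hne].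
  - rewrite Nat.ltb_irrefl. destruct (Nat.ltb_spec q (S q)); [ring|lia].
  - destruct (Nat.ltb_spec q N); destruct (Nat.ltb_spec q (S N)); try lia; ring.
Qed.

Lemma comb_bound (B : nat -> R) (f : nat -> R -> R) (N : nat) (x e S : R) :
  (forall j, (j < N)%nat -> Rabs (B j) <= e) ->
  (forall j, (j < N)%nat -> Rabs (f j x) <= S) ->
  Rabs (comb B f N x) <= INR N * (e * S).
Proof.
  induction N as [|N IH]; intros HB Hf.
  - simpl. rewrite Rabs_R0. lra.
  - simpl comb. rewrite S_INR.
    eapply Rle_trans; [apply Rabs_triang|]. rewrite Rabs_mult.
    assert (A : Rabs (B N) * Rabs (f N x) <= e * S)
      by (apply Rmult_le_compat; try apply Rabs_pos; auto).
    assert (H : Rabs (comb B f N x) <= INR N * (e * S)) by (apply IH; auto).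
    lra.
Qed.

Lemma comb_near_single (B : nat -> R) (f : nat -> R -> R) (N q : nat) (x e S : R) :
  (q < N)%nat ->
  (forall j, (j < N)%nat -> Rabs (B j - delta q j) <= e) ->
  (forall j, (j < N)%nat -> Rabs (f j x) <= S) ->
  Rabs (comb B f N x - f q x) <= INR N * (e * S).
Proof.
  intros Hq HB Hf.
  assert (E := comb_delta q f N x). destruct (Nat.ltb_spec q N); [|lia].
  rewrite <- E, <- comb_minus. now apply comb_bound.
Qed.

Lemma comb_continuity (B : nat -> R) (f : nat -> R -> R) (N : nat) :
  (forall j, continuity (f j)) -> continuity (comb B f N).
Proof.
  intros Hf. induction N as [|N IH]; intros x.
  - apply continuity_pt_const. now intros ? ?.
  - apply (continuity_pt_plus (comb B f N) (fun x => B N * f N x)); [apply IH|].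
    apply continuity_pt_mult; [apply continuity_pt_const; now intros ? ?|apply Hf].
Qed.

Lemma comb_derive (B : nat -> R) (f df : nat -> R -> R) (N : nat) (x : R) :
  (forall j, is_derive (f j) x (df j x)) -> is_derive (comb B f N) x (comb B df N x).
Proof.
  intros Hf. induction N as [|N IH].
  - apply @is_derive_const.
  - apply (@is_derive_plus R_AbsRing R_NormedModule (comb B f N) (fun x => B N * f N x));
      [exact IH|]. apply is_derive_scal, Hf.
Qed.

(** * Scalar differential equations by Picard iteration *)

Lemma continuity_ex_RInt (f : R -> R) (a b : R) : continuity f -> ex_RInt f a b.
Proof.
  intros Hf. apply (@ex_RInt_continuous R_CompleteNormedModule).
  intros z _. apply continuity_pt_filterlim, Hf.
Qed.

Lemma is_derive_primitive (f : R -> R) (a x : R) :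
  continuity f -> is_derive (fun y => RInt f a y) x (f x).
Proof.
  intros Hf. apply (@is_derive_RInt R_CompleteNormedModule _ _ a).
  - apply filter_forall. intros y.
    apply (@RInt_correct R_CompleteNormedModule), continuity_ex_RInt, Hf.
  - apply continuity_pt_filterlim, Hf.
Qed.

(** Both g - RInt f a and g + RInt f a have a nonnegative derivative. *)
Lemma primitive_bound (f g dg : R -> R) (a x : R) :
  continuity f -> a <= x ->
  (forall t, is_derive g t (dg t)) ->
  (forall t, a < t < x -> Rabs (f t) <= dg t) ->
  Rabs (RInt f a x) <= g x - g a.
Proof.
  intros Hf Hax Hg Hb.
  assert (E0 : RInt f a a = 0) by apply (@RInt_point R_CompleteNormedModule).
  assert (HP : forall t, is_derive (fun y => RInt f a y) t (f t))
    by (intros; apply is_derive_primitive, Hf).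
  assert (H1 : g a - RInt f a a <= g x - RInt f a x).
  { apply (nondecreasing_of_derive (fun y => g y - RInt f a y) (fun y => dg y - f y)); auto.
    - intros t Ht. split; [apply @is_derive_minus; auto|].
      specialize (Hb t Ht). apply Rabs_le_between in Hb. lra.
    - intros t _. apply continuity_pt_minus; eapply is_derive_continuity_pt; eauto. }
  assert (H2 : g a + RInt f a a <= g x + RInt f a x).
  { apply (nondecreasing_of_derive (fun y => g y + RInt f a y) (fun y => dg y + f y)); auto.
    - intros t Ht. split; [apply @is_derive_plus; auto|].
      specialize (Hb t Ht). apply Rabs_le_between in Hb. lra.
    - intros t _. apply continuity_pt_plus; eapply is_derive_continuity_pt; eauto. }
  apply Rabs_le_between. lra.
Qed.

(** The bound for the tail is the sum of the remaining steps; it also shows that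
    [Lim_seq u] is finite. *)
Lemma geometric_limit (u : nat -> R) (D : R) :
  (forall n, Rabs (u (S n) - u n) <= D / 2 ^ n) ->
  forall n, Rabs (real (Lim_seq u) - u n) <= 2 * D / 2 ^ n.
Proof.
  intros Hu.
  assert (H2 : forall n, 0 < 2 ^ n) by (intros; apply pow_lt; lra).
  assert (HD : 0 <= D).
  { specialize (Hu 0%nat). simpl in Hu. assert (A := Rabs_pos (u 1%nat - u 0%nat)). lra. }
  assert (Hk : forall n k, Rabs (u (n + k)%nat - u n) <= 2 * D / 2 ^ n - 2 * D / 2 ^ (n + k)).
  { intros n k. induction k as [|k IH].
    - rewrite Nat.add_0_r, Rminus_diag, Rabs_R0. lra.
    - replace (u (n + S k)%nat - u n)
        with ((u (S (n + k)) - u (n + k)%nat) + (u (n + k)%nat - u n))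
        by (rewrite Nat.add_succ_r; ring).
      eapply Rle_trans; [apply Rabs_triang|].
      specialize (Hu (n + k)%nat). rewrite Nat.add_succ_r. simpl.
      assert (P := H2 (n + k)%nat).
      replace (2 * D / (2 * 2 ^ (n + k))) with (D / 2 ^ (n + k)) by (field; lra).
      replace (2 * D / 2 ^ (n + k)) with (D / 2 ^ (n + k) + D / 2 ^ (n + k)) in IH by (field; lra).
      lra. }
  assert (Hk' : forall n k, Rabs (u (n + k)%nat - u n) <= 2 * D / 2 ^ n).
  { intros n k. eapply Rle_trans; [apply Hk|].
    assert (0 <= 2 * D / 2 ^ (n + k)); [|lra].
    apply Rmult_le_pos; [lra|]. apply Rlt_le, Rinv_0_lt_compat, H2. }
  assert (Hcv : ex_finite_lim_seq u).
  { apply ex_lim_seq_cauchy_corr. intros eps.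
    destruct (small_geometric (2 * D) (eps / 2)) as [N HN]; [apply is_pos_div_2|].
    exists N. intros i j Hi Hj.
    replace i with (N + (i - N))%nat by lia. replace j with (N + (j - N))%nat by lia.
    assert (A1 := Hk' N (i - N)%nat). assert (A2 := Hk' N (j - N)%nat).
    apply Rabs_le_between in A1. apply Rabs_le_between in A2.
    apply Rabs_def1; lra. }
  intros n.
  destruct Hcv as [l Hl]. rewrite (is_lim_seq_unique _ _ Hl). simpl.
  apply Rabs_le_between.
  assert (Hl' := proj1 (is_lim_seq_incr_n u n l) Hl).
  split.
  - assert (A : Rbar_le (u n - 2 * D / 2 ^ n) l).
    { apply (is_lim_seq_le (fun _ => u n - 2 * D / 2 ^ n) (fun k => u (k + n)%nat)); auto.
      - intros k. specialize (Hk' n k). rewrite Nat.add_comm.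
        apply Rabs_le_between in Hk'. lra.
      - apply is_lim_seq_const. }
    simpl in A. lra.
  - assert (A : Rbar_le l (u n + 2 * D / 2 ^ n)).
    { apply (is_lim_seq_le (fun k => u (k + n)%nat) (fun _ => u n + 2 * D / 2 ^ n)); auto.
      - intros k. specialize (Hk' n k). rewrite Nat.add_comm.
        apply Rabs_le_between in Hk'. lra.
      - apply is_lim_seq_const. }
    simpl in A. lra.
Qed.

Lemma Rplus_minus_r_cancel (w u v : R) : w + u - (w + v) = u - v.
Proof. ring. Qed.

Section Picard.

Variables (a b gam M B : R) (F : R -> R -> R).
Hypothesis Hab : a <= b.
Hypothesis HM : 0 < M.
Hypothesis Fcont : forall phi, continuity phi -> continuity (fun t => F t (phi t)).
Hypothesis Flip : forall t y z, Rabs (F t y - F t z) <= M * Rabs (y - z).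
Hypothesis Fbound : forall t y, Rabs (F t y) <= B.

(** The clamp makes every iterate defined and continuous on the whole line. *)
Fixpoint picard (n : nat) : R -> R :=
  match n with
  | O => fun _ => gam
  | S n => fun x => gam + RInt (fun t => F t (picard n t)) a (clamp a b x)
  end.

Definition picard_limit (x : R) : R := real (Lim_seq (fun n => picard n x)).

Lemma picard_continuity (n : nat) : continuity (picard n).
Proof.
  induction n as [|n IH]; intros x.
  - apply continuity_pt_const. now intros ? ?.
  - simpl. apply continuity_pt_plus; [apply continuity_pt_const; now intros ? ?|].
    apply (continuity_clamp a b (fun y => RInt (fun t => F t (picard n t)) a y) Hab).
    intros y _. eapply is_derive_continuity_pt, is_derive_primitive, Fcont, IH.
Qed.

Lemma RInt_difference (f g : R -> R) (x : R) :
  continuity f -> continuity g ->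
  RInt f a x - RInt g a x = RInt (fun t => f t - g t) a x.
Proof.
  intros Hf Hg. symmetry.
  apply (@RInt_minus R_CompleteNormedModule); now apply continuity_ex_RInt.
Qed.

(** The weight exp (2 M (x - a)) makes the integral operator a contraction of ratio
    1/2: its primitive brings a factor 1 / (2 M), against the Lipschitz constant M. *)
Lemma picard_gap (n : nat) (x : R) :
  Rabs (picard (S n) x - picard n x)
  <= B * (b - a) / 2 ^ n * exp (2 * M * (clamp a b x - a)).
Proof.
  assert (HB : 0 <= B) by (assert (A := Fbound 0 0); assert (A' := Rabs_pos (F 0 0)); lra).
  revert x. induction n as [|n IH]; intros x;
    assert (Hx := clamp_in a b x Hab); set (y := clamp a b x) in *.
  - simpl. fold y.
    assert (H1 : Rabs (RInt (fun t => F t gam) a y) <= B * y - B * a).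
    { apply (primitive_bound _ (fun t => B * t) (fun _ => B)).
      - apply (Fcont (fun _ => gam)). intros ?. apply continuity_pt_const. now intros ? ?.
      - lra.
      - intros t. auto_derive; auto. ring.
      - intros t _. apply Fbound. }
    rewrite Rplus_minus_l.
    eapply Rle_trans; [exact H1|].
    assert (H2 : 1 <= exp (2 * M * (y - a))).
    { assert (A := exp_ineq1_le (2 * M * (y - a))).
      assert (0 <= 2 * M * (y - a)) by (apply Rmult_le_pos; lra). lra. }
    assert (0 <= B * (b - a)) by (apply Rmult_le_pos; lra).
    assert (B * y <= B * b) by (apply Rmult_le_compat_l; lra).
    apply Rle_trans with (B * (b - a)); [lra|].
    unfold Rdiv. rewrite Rinv_1, Rmult_1_r.
    rewrite <- (Rmult_1_r (B * (b - a))) at 1. now apply Rmult_le_compat_l.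
  - set (C := B * (b - a) / 2 ^ n).
    change (Rabs (gam + RInt (fun t => F t (picard (S n) t)) a y
                  - (gam + RInt (fun t => F t (picard n t)) a y))
            <= B * (b - a) / 2 ^ S n * exp (2 * M * (y - a))).
    rewrite (Rplus_minus_r_cancel gam).
    assert (C1 : continuity (fun t => F t (picard (S n) t))) by apply Fcont, picard_continuity.
    assert (C2 : continuity (fun t => F t (picard n t))) by apply Fcont, picard_continuity.
    rewrite RInt_difference by assumption.
    eapply Rle_trans.
    + apply (primitive_bound _ (fun t => C / 2 * exp (2 * M * (t - a)))
               (fun t => M * (C * exp (2 * M * (t - a))))).
      * intros t. apply continuity_pt_minus; auto.
      * lra.
      * intros t. auto_derive; auto. unfold Rminus. field.
      * intros t Ht. eapply Rle_trans; [apply Flip|].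
        apply Rmult_le_compat_l; [lra|].
        specialize (IH t). rewrite (clamp_id a b t) in IH by lra. exact IH.
    + rewrite Rminus_diag, Rmult_0_r, exp_0.
      assert (0 <= C).
      { unfold C. apply Rmult_le_pos; [apply Rmult_le_pos; lra|].
        apply Rlt_le, Rinv_0_lt_compat, pow_lt. lra. }
      replace (B * (b - a) / 2 ^ S n) with (C / 2)
        by (unfold C; simpl; field; apply pow_nonzero; lra). lra.
Qed.

Let D := B * (b - a) * exp (2 * M * (b - a)).

Lemma picard_limit_error (n : nat) (x : R) :
  Rabs (picard_limit x - picard n x) <= 2 * D / 2 ^ n.
Proof.
  apply (geometric_limit (fun k => picard k x) D). clear n. intros n.
  eapply Rle_trans; [apply picard_gap|].
  assert (HB : 0 <= B) by (assert (A := Fbound 0 0); assert (A' := Rabs_pos (F 0 0)); lra).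
  assert (P : 0 < 2 ^ n) by (apply pow_lt; lra).
  replace (D / 2 ^ n) with (B * (b - a) / 2 ^ n * exp (2 * M * (b - a)))
    by (unfold D; field; lra).
  apply Rmult_le_compat_l.
  - apply Rmult_le_pos; [apply Rmult_le_pos; lra|]. now apply Rlt_le, Rinv_0_lt_compat.
  - assert (Hx := clamp_in a b x Hab).
    assert (E : 2 * M * (clamp a b x - a) <= 2 * M * (b - a)) by (apply Rmult_le_compat_l; lra).
    destruct E as [E| ->]; [apply Rlt_le, exp_increasing, E | apply Rle_refl].
Qed.

Lemma picard_limit_continuity : continuity picard_limit.
Proof.
  intros x. apply continuity_pt_of_eps. intros eps He.
  destruct (small_geometric (2 * D) (eps / 3)) as [n Hn]; [lra|].
  destruct (continuity_pt_eps _ _ (picard_continuity n x) (eps / 3)) as (d & Hd & Hy); [lra|].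
  exists d. split; [exact Hd|]. intros y Hyx. specialize (Hy y Hyx).
  assert (E1 := picard_limit_error n x). assert (E2 := picard_limit_error n y).
  apply Rabs_le_between in E1. apply Rabs_le_between in E2. apply Rabs_def2 in Hy.
  apply Rabs_def1; lra.
Qed.

Lemma picard_limit_fixpoint (x : R) :
  picard_limit x = gam + RInt (fun t => F t (picard_limit t)) a (clamp a b x).
Proof.
  apply Rminus_diag_uniq, cond_eq. intros eps He.
  rewrite Rminus_0_r.
  assert (Hx := clamp_in a b x Hab). set (y := clamp a b x) in *.
  destruct (small_geometric (2 * D + M * (2 * D) * (b - a)) eps He) as [n Hn].
  assert (P : 0 < 2 ^ n) by (apply pow_lt; lra).
  assert (E1 := picard_limit_error (S n) x).
  assert (C1 : continuity (fun t => F t (picard_limit t)))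
    by apply Fcont, picard_limit_continuity.
  assert (C2 : continuity (fun t => F t (picard n t))) by apply Fcont, picard_continuity.
  assert (E2 : Rabs (RInt (fun t => F t (picard_limit t) - F t (picard n t)) a y)
               <= M * (2 * D / 2 ^ n) * y - M * (2 * D / 2 ^ n) * a).
  { apply (primitive_bound _ (fun t => M * (2 * D / 2 ^ n) * t) (fun _ => M * (2 * D / 2 ^ n))).
    - intros t. apply continuity_pt_minus; auto.
    - lra.
    - intros t. auto_derive; auto. ring.
    - intros t _. eapply Rle_trans; [apply Flip|].
      apply Rmult_le_compat_l; [lra|apply picard_limit_error]. }
  rewrite <- RInt_difference in E2 by assumption.
  change (picard (S n) x) with (gam + RInt (fun t => F t (picard n t)) a y) in E1.
  assert (HD : 0 <= 2 * D / 2 ^ n).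
  { eapply Rle_trans; [|apply (picard_limit_error n x)]. apply Rabs_pos. }
  assert (E3 : 2 * D / 2 ^ S n <= 2 * D / 2 ^ n).
  { simpl. replace (2 * D / (2 * 2 ^ n)) with (2 * D / 2 ^ n / 2) by (field; lra). lra. }
  assert (E4 : M * (2 * D / 2 ^ n) * (y - a) <= M * (2 * D / 2 ^ n) * (b - a)).
  { apply Rmult_le_compat_l; [apply Rmult_le_pos; lra|lra]. }
  replace ((2 * D + M * (2 * D) * (b - a)) / 2 ^ n)
    with (2 * D / 2 ^ n + M * (2 * D / 2 ^ n) * (b - a)) in Hn by (field; lra).
  apply Rabs_le_between in E1. apply Rabs_le_between in E2.
  apply Rabs_def1; lra.
Qed.

Theorem picard_limit_solves :
  continuity picard_limit /\ picard_limit a = gam /\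
  forall x, a < x < b -> is_derive picard_limit x (F x (picard_limit x)).
Proof.
  assert (C1 : continuity (fun t => F t (picard_limit t)))
    by apply Fcont, picard_limit_continuity.
  split; [exact picard_limit_continuity|]. split.
  - rewrite picard_limit_fixpoint, clamp_id by lra.
    rewrite (@RInt_point R_CompleteNormedModule). apply Rplus_0_r.
  - intros x Hx.
    apply (is_derive_ext_loc (fun y => gam + RInt (fun t => F t (picard_limit t)) a y)).
    + apply (filter_imp (fun y => clamp a b y = y)).
      * intros y Hy. rewrite picard_limit_fixpoint, Hy. reflexivity.
      * now apply locally_clamp_id.
    + evar_last.
      * apply @is_derive_plus; [apply @is_derive_const|].
        now apply (is_derive_primitive (fun t => F t (picard_limit t))).
      * apply Rplus_0_l.
Qed.

End Picard.

(** * The Pruefer angle *)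

Section Pruefer.

(* The coefficients are taken on the whole line, extended by constants beyond
   [a, b]; k stands for 1 / K.  The bounds c and C are common to the three of them. *)
Variables (a b c C gam : R) (k g l : R -> R).
Hypothesis Hab : a < b.
Hypothesis kcont : continuity k.
Hypothesis gcont : continuity g.
Hypothesis lcont : continuity l.
Hypothesis cpos : 0 < c.
Hypothesis kbd : forall x, c <= k x <= C.
Hypothesis gbd : forall x, c <= g x <= C.
Hypothesis lbd : forall x, c <= l x <= C.

Definition potential (r x : R) : R := r * g x - l x.

(** The right-hand side of the Pruefer equation: the derivative of the angle y of
    the vector (v, p), measured from the p-axis. *)
Definition flux (r x y : R) : R :=
  k x * (cos y * cos y) + potential r x * (sin y * sin y).

(** A common bound for the flux and for its Lipschitz constant in the angle. *)
Definition rate (r : R) : R := (2 + Rabs r) * C.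

Lemma C_pos : 0 < C.
Proof. destruct (kbd 0). lra. Qed.

Lemma rate_pos (r : R) : 0 < rate r.
Proof.
  assert (A := Rabs_pos r). assert (B := C_pos).
  unfold rate. apply Rmult_lt_0_compat; lra.
Qed.

Lemma coefficient_gap (r x : R) : Rabs (k x - potential r x) <= rate r.
Proof.
  unfold potential, rate. destruct (kbd x), (gbd x), (lbd x).
  assert (A1 := Rle_abs r). assert (A2 := Rle_abs (- r)). rewrite Rabs_Ropp in A2.
  assert (A3 := Rabs_pos r). apply Rabs_le_between. split; nra.
Qed.

Lemma potential_continuity (r : R) : continuity (potential r).
Proof.
  intros x. unfold potential.
  apply continuity_pt_minus; [|apply lcont].
  apply continuity_pt_mult; [apply continuity_pt_const; now intros ? ?|apply gcont].
Qed.

Lemma flux_lipschitz (r x y z : R) : Rabs (flux r x y - flux r x z) <= rate r * Rabs (y - z).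
Proof.
  apply (bounded_derive_lipschitz (flux r x)
           (fun y => 2 * (- (k x - potential r x) * (sin y * cos y)))).
  - intros t. unfold flux. auto_derive; auto. ring.
  - intros t.
    replace (2 * (- (k x - potential r x) * (sin t * cos t)))
      with ((- (k x - potential r x)) * sin (2 * t)) by (rewrite sin_2a; ring).
    rewrite Rabs_mult, Rabs_Ropp. rewrite <- (Rmult_1_r (rate r)).
    apply Rmult_le_compat; try apply Rabs_pos; [apply coefficient_gap|].
    apply Rabs_le_between. apply SIN_bound.
Qed.

Lemma flux_continuity (r : R) (phi : R -> R) :
  continuity phi -> continuity (fun t => flux r t (phi t)).
Proof.
  intros Hphi x. unfold flux.
  assert (Hcs := continuity_cos_comp phi Hphi x).
  assert (Hsn := continuity_sin_comp phi Hphi x).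
  apply continuity_pt_plus; apply continuity_pt_mult;
    try (apply continuity_pt_mult; assumption); [apply kcont|apply potential_continuity].
Qed.

Lemma flux_bound (r t y : R) : Rabs (flux r t y) <= rate r.
Proof.
  unfold flux, rate, potential. destruct (kbd t), (gbd t), (lbd t).
  assert (A1 := Rle_abs r). assert (A2 := Rle_abs (- r)). rewrite Rabs_Ropp in A2.
  assert (A3 := Rabs_pos r).
  assert (E := sin_cos_sqr y).
  assert (P1 : 0 <= sin y * sin y) by apply Rle_0_sqr.
  assert (P2 : 0 <= cos y * cos y) by apply Rle_0_sqr.
  set (S := sin y * sin y) in *. set (Q := cos y * cos y) in *.
  assert (B1 : Rabs (r * g t - l t) <= (1 + Rabs r) * C)
    by (apply Rabs_le_between; split; nra).
  apply Rabs_le_between in B1.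
  apply Rabs_le_between. split; nra.
Qed.

Definition angle (r : R) (th : R -> R) : Prop :=
  continuity th /\ th a = gam /\
  forall x, a < x < b -> is_derive th x (flux r x (th x)).

Definition theta (r : R) : R -> R := picard_limit a b gam (flux r).

Lemma theta_angle (r : R) : angle r (theta r).
Proof.
  apply (picard_limit_solves a b gam (rate r) (rate r)).
  - lra.
  - apply rate_pos.
  - apply flux_continuity.
  - apply flux_lipschitz.
  - apply flux_bound.
Qed.

Lemma flux_increment (r s x y : R) : flux s x y = flux r x y + (s - r) * g x * (sin y * sin y).
Proof. unfold flux, potential. ring. Qed.

(** Where ph - th is negative, the Lipschitz bound makes its derivative at least
    rate r times its value, the additional term (s - r) g sin^2 ph being nonnegative. *)
Lemma angle_monotone (r s : R) (th ph : R -> R) :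
  angle r th -> angle s ph -> r <= s -> forall x, a <= x <= b -> th x <= ph x.
Proof.
  intros (Ct & At & Dt) (Cp & Ap & Dp) Hrs x Hx.
  enough (0 <= ph x - th x) by lra.
  apply (nonneg_propagates (fun y => ph y - th y)
           (fun y => flux s y (ph y) - flux r y (th y)) a x 1 (rate r)); try lra.
  - intros y _. apply continuity_pt_minus; auto.
  - intros y Hy. apply @is_derive_minus; [apply Dp|apply Dt]; lra.
  - intros y Hy Hd. rewrite (flux_increment r s).
    assert (HL := flux_lipschitz r y (ph y) (th y)).
    rewrite (Rabs_left (ph y - th y)) in HL by lra.
    apply Rabs_le_between in HL.
    assert (0 <= (s - r) * g y * (sin (ph y) * sin (ph y))).
    { apply Rmult_le_pos; [|apply Rle_0_sqr]. destruct (gbd y).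
      apply Rmult_le_pos; lra. }
    lra.
Qed.

(** Where sin th vanishes on an interval, differentiating gives flux cos th = 0,
    whereas there the flux equals k > 0 and cos th is 1 or -1. *)
Lemma angle_leaves_levels (r : R) (th : R -> R) :
  angle r th -> exists x, a < x < b /\ sin (th x) <> 0.
Proof.
  intros (_ & _ & Dt). apply NNPP. intros Hno.
  assert (Hsin : forall x, a < x < b -> sin (th x) = 0).
  { intros x Hx. apply NNPP. intros Hne. apply Hno. now exists x. }
  set (x := (a + b) / 2). assert (Hx : a < x < b) by (unfold x; lra).
  assert (E : flux r x (th x) * cos (th x) = 0).
  { apply (derive_eq_on_interval (fun y => sin (th y)) (fun _ => 0) _ _ a b x Hx Hsin).
    - now apply is_derive_sin_comp, Dt.
    - apply @is_derive_const. }
  assert (S := Hsin x Hx). assert (T := sin_cos_sqr (th x)).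
  unfold flux in E. rewrite S in *. destruct (kbd x).
  assert (Hcc : cos (th x) * cos (th x) = 1) by lra.
  rewrite Hcc in E.
  assert (cos (th x) <> 0) by (intros Z; rewrite Z in Hcc; lra).
  apply Rmult_integral in E as [E|E]; [lra|contradiction].
Qed.

(** If the angles agreed at b, the function exp (rate r x) (ph - th) would be
    nondecreasing, nonnegative, and zero at b, hence identically zero.  Then the two
    fluxes agree, which forces sin ph = 0 throughout. *)
Lemma angle_strictly_monotone (r s : R) (th ph : R -> R) :
  angle r th -> angle s ph -> r < s -> th b < ph b.
Proof.
  intros Ht Hp Hrs.
  assert (Hmon := angle_monotone r s th ph Ht Hp (Rlt_le _ _ Hrs)).
  destruct Ht as (Ct & At & Dt). destruct Hp as (Cp & Ap & Dp).
  destruct (Hmon b) as [|Eb]; [lra|assumption|exfalso].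
  assert (Hinc : forall x, a < x < b ->
            0 <= flux s x (ph x) - flux r x (th x) + rate r * (ph x - th x)).
  { intros y Hy. rewrite (flux_increment r s).
    assert (HL := flux_lipschitz r y (ph y) (th y)).
    assert (M := Hmon y ltac:(lra)).
    rewrite (Rabs_pos_eq (ph y - th y)) in HL by lra.
    apply Rabs_le_between in HL.
    assert (0 <= (s - r) * g y * (sin (ph y) * sin (ph y))).
    { apply Rmult_le_pos; [|apply Rle_0_sqr]. destruct (gbd y).
      apply Rmult_le_pos; lra. }
    lra. }
  assert (Heq : forall x, a <= x <= b -> ph x = th x).
  { intros x Hx.
    assert (E : exp (- - rate r * x) * (ph x - th x) <= exp (- - rate r * b) * (ph b - th b)).
    { apply (nondecreasing_of_derive (fun y => exp (- - rate r * y) * (ph y - th y))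
               (fun y => exp (- - rate r * y) *
                  (flux s y (ph y) - flux r y (th y) - (- rate r) * (ph y - th y)))).
      - lra.
      - intros y Hy. split.
        + apply (weighted_derive (fun y => ph y - th y)
                   (fun y => flux s y (ph y) - flux r y (th y))).
          apply @is_derive_minus; [apply Dp|apply Dt]; lra.
        + apply Rmult_le_pos; [apply Rlt_le, exp_pos|].
          specialize (Hinc y ltac:(lra)). lra.
      - intros y _. apply (continuity_pt_weighted (fun y => ph y - th y)).
        apply continuity_pt_minus; auto. }
    rewrite Eb, Rminus_diag, Rmult_0_r in E.
    assert (P := exp_pos (- - rate r * x)). specialize (Hmon x Hx). nra. }
  destruct (angle_leaves_levels s ph (conj Cp (conj Ap Dp))) as (x & Hx & Hsin).
  assert (E : flux s x (ph x) = flux r x (th x)).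
  { apply (derive_eq_on_interval ph th _ _ a b x Hx); auto.
    intros t Ht. apply Heq. lra. }
  rewrite (flux_increment r s), <- (Heq x) in E by lra.
  assert (E' : (s - r) * g x * (sin (ph x) * sin (ph x)) = 0) by lra.
  destruct (gbd x).
  apply Rmult_integral in E' as [E'|E'].
  - apply Rmult_integral in E' as [E'|E']; lra.
  - apply Rmult_integral in E' as [E'|E']; contradiction.
Qed.

Lemma flux_gap (r s x y z : R) :
  Rabs (flux s x y - flux r x z) <= rate r * Rabs (y - z) + Rabs (s - r) * C.
Proof.
  rewrite (flux_increment r s).
  replace (flux r x y + (s - r) * g x * (sin y * sin y) - flux r x z)
    with ((flux r x y - flux r x z) + (s - r) * (g x * (sin y * sin y))) by ring.
  eapply Rle_trans; [apply Rabs_triang|].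
  apply Rplus_le_compat; [apply flux_lipschitz|].
  rewrite Rabs_mult. apply Rmult_le_compat_l; [apply Rabs_pos|].
  destruct (gbd x). assert (T := sin_cos_sqr y).
  assert (0 <= sin y * sin y) by apply Rle_0_sqr.
  assert (0 <= cos y * cos y) by apply Rle_0_sqr.
  rewrite Rabs_pos_eq; nra.
Qed.

(** Gronwall's inequality: exp (- M x) (d + E / M) is nonincreasing. *)
Lemma growth_bound (d dd : R -> R) (M E : R) :
  0 < M -> continuity d -> d a = 0 ->
  (forall x, a < x < b -> is_derive d x (dd x) /\ dd x <= M * d x + E) ->
  d b <= E / M * (exp (M * (b - a)) - 1).
Proof.
  intros HM Cd Ad Dd.
  assert (H : exp (- M * a) * (- (d a + E / M)) <= exp (- M * b) * (- (d b + E / M))).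
  { apply (nondecreasing_of_derive (fun y => exp (- M * y) * (- (d y + E / M)))
             (fun y => exp (- M * y) * (- dd y - M * (- (d y + E / M))))).
    - lra.
    - intros y Hy. destruct (Dd y Hy) as [D1 D2]. split.
      + apply (weighted_derive (fun y => - (d y + E / M)) (fun y => - dd y)).
        apply @is_derive_opp. evar_last.
        * apply @is_derive_plus; [apply D1|apply @is_derive_const].
        * apply Rplus_0_r.
      + apply Rmult_le_pos; [apply Rlt_le, exp_pos|].
        replace (- dd y - M * - (d y + E / M)) with (M * d y + E - dd y) by (field; lra). lra.
    - intros y _. apply (continuity_pt_weighted (fun y => - (d y + E / M))).
      apply continuity_pt_opp, continuity_pt_plus; [apply Cd|].
      apply continuity_pt_const. now intros ? ?. }
  rewrite Ad in H.
  apply (Rmult_le_compat_l (exp (M * b))) in H; [|apply Rlt_le, exp_pos].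
  rewrite <- !Rmult_assoc, <- !exp_plus in H.
  replace (M * b + - M * b) with 0 in H by ring.
  replace (M * b + - M * a) with (M * (b - a)) in H by ring.
  rewrite exp_0 in H. lra.
Qed.

(** Gronwall's inequality for the difference of two angles, always with the Lipschitz
    constant of the fixed parameter r, gives a Lipschitz estimate at r. *)
Lemma theta_end_continuity : continuity (fun r => theta r b).
Proof.
  intros r. apply continuity_pt_of_eps. intros eps He.
  set (M := rate r). assert (HM : 0 < M) by apply rate_pos.
  set (W := C / M * (exp (M * (b - a)) - 1)).
  assert (HC := C_pos).
  assert (Hord : forall s t, s <= t -> r = s \/ r = t ->
            theta t b - theta s b <= (t - s) * W).
  { intros s t Hst Hr.
    assert (Hm := angle_monotone s t _ _ (theta_angle s) (theta_angle t) Hst).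
    destruct (theta_angle s) as (Cs & As & Ds). destruct (theta_angle t) as (Ct & At & Dt).
    replace ((t - s) * W) with ((t - s) * C / M * (exp (M * (b - a)) - 1))
      by (unfold W; field; lra).
    apply (growth_bound (fun y => theta t y - theta s y)
             (fun y => flux t y (theta t y) - flux s y (theta s y))); auto.
    - intros y. apply continuity_pt_minus; auto.
    - lra.
    - intros y Hy. split; [apply @is_derive_minus; auto|].
      specialize (Hm y ltac:(lra)).
      assert (HG : Rabs (flux t y (theta t y) - flux s y (theta s y))
                   <= M * Rabs (theta t y - theta s y) + Rabs (t - s) * C).
      { destruct Hr as [<-| <-]; [apply flux_gap|].
        rewrite Rabs_minus_sym, (Rabs_minus_sym (theta r y)), (Rabs_minus_sym r).
        apply flux_gap. }
      rewrite (Rabs_pos_eq (_ - theta s y)), (Rabs_pos_eq (t - s)) in HG by lra.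
      apply Rabs_le_between in HG. lra. }
  assert (Hlip : forall s, Rabs (theta s b - theta r b) <= Rabs (s - r) * W).
  { intros s. destruct (Rle_lt_dec r s) as [Hrs|Hrs].
    - assert (Hm := angle_monotone r s _ _ (theta_angle r) (theta_angle s) Hrs b ltac:(lra)).
      rewrite !Rabs_pos_eq by lra. apply Hord; auto.
    - assert (Hm := angle_monotone s r _ _ (theta_angle s) (theta_angle r)
                      (Rlt_le _ _ Hrs) b ltac:(lra)).
      rewrite (Rabs_minus_sym s), (Rabs_minus_sym (theta s b)).
      rewrite !Rabs_pos_eq by lra. apply Hord; [lra|auto]. }
  assert (HW : 0 <= W).
  { specialize (Hlip (r + 1)). replace (r + 1 - r) with 1 in Hlip by ring.
    rewrite Rabs_R1 in Hlip. assert (A := Rabs_pos (theta (r + 1) b - theta r b)). lra. }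
  exists (eps / (W + 1)). split; [apply Rdiv_lt_0_compat; lra|].
  intros s Hs. eapply Rle_lt_trans; [apply Hlip|].
  apply Rle_lt_trans with (Rabs (s - r) * (W + 1)).
  - apply Rmult_le_compat_l; [apply Rabs_pos|lra].
  - apply (Rmult_lt_compat_r (W + 1)) in Hs; [|lra].
    replace (eps / (W + 1) * (W + 1)) with eps in Hs by (field; lra). exact Hs.
Qed.

(** Small enough for the flux to be positive within twice this distance of every
    level.  The bound PI / 8 keeps the neighbourhoods of distinct levels apart and
    gives sin eta <= cos eta for every smaller eta. *)
Definition margin (r : R) : R := Rmin (PI / 8) (c / (4 * rate r)).

Lemma margin_pos (r : R) : 0 < margin r.
Proof.
  assert (A := PI_RGT_0). assert (B := rate_pos r).
  apply Rmin_glb_lt; [lra|]. apply Rdiv_lt_0_compat; lra.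
Qed.

(** At a level the flux is k, and the Lipschitz bound allows it to decrease by at
    most c / 2. *)
Lemma flux_pos_near_level (r x y : R) (j : Z) :
  Rabs (y - IZR j * PI) <= 2 * margin r -> 0 < flux r x y.
Proof.
  intros H. assert (HL := flux_lipschitz r x y (IZR j * PI)).
  assert (E : flux r x (IZR j * PI) = k x).
  { unfold flux. assert (S := sin_level j). assert (T := sin_cos_sqr (IZR j * PI)).
    rewrite S in *. replace (cos (IZR j * PI) * cos (IZR j * PI)) with 1 by lra. ring. }
  rewrite E in HL. assert (B := rate_pos r).
  assert (H2 : 2 * margin r <= c / (2 * rate r)).
  { assert (A := Rmin_r (PI / 8) (c / (4 * rate r))). fold (margin r) in A.
    replace (c / (2 * rate r)) with (2 * (c / (4 * rate r))) by (field; lra). lra. }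
  assert (H3 : rate r * Rabs (y - IZR j * PI) <= c / 2).
  { replace (c / 2) with (rate r * (c / (2 * rate r))) by (field; lra).
    apply Rmult_le_compat_l; lra. }
  apply Rabs_le_between in HL. destruct (kbd x). lra.
Qed.

(** The angle increases as long as it is near a level.  The shift tau is there because
    a perturbed eigenfunction has its zeros near the levels, not on them. *)
Lemma crosses_upward (r : R) (th : R -> R) (j : Z) (tau x y : R) :
  angle r th -> Rabs tau <= margin r -> a <= x -> x <= y -> y <= b ->
  IZR j * PI + tau <= th x -> IZR j * PI + tau <= th y.
Proof.
  intros (Ct & _ & Dt) Htau Hax Hxy Hyb Hx.
  enough (0 <= th y - (IZR j * PI + tau)) by lra.
  assert (Hm := margin_pos r).
  apply (nonneg_propagates (fun t => th t - (IZR j * PI + tau))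
           (fun t => flux r t (th t)) x y (margin r) 0); try lra.
  - intros t _. apply continuity_pt_minus; [apply Ct|]. apply continuity_pt_const. now intros ? ?.
  - intros t Ht. evar_last.
    + apply @is_derive_minus; [apply Dt; lra|apply @is_derive_const].
    + apply Rminus_0_r.
  - intros t Ht Hd. rewrite Rmult_0_l. apply Rlt_le, (flux_pos_near_level r t _ j).
    apply Rabs_le_between in Htau. apply Rabs_le_between. lra.
Qed.

(** An angle back at the level at y cannot have been above it before, so it would
    be constant on [x, y], where its derivative is positive. *)
Lemma crosses_strictly (r : R) (th : R -> R) (j : Z) (x y : R) :
  angle r th -> a <= x -> x < y -> y <= b ->
  IZR j * PI <= th x -> IZR j * PI < th y.
Proof.
  intros Ht Hax Hxy Hyb Hx. assert (Hm := margin_pos r).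
  assert (Hge : forall t, x <= t <= y -> IZR j * PI <= th t).
  { intros t Ht'. assert (A : IZR j * PI + 0 <= th t); [|lra].
    apply (crosses_upward r th j 0 x t); auto; try lra. rewrite Rabs_R0. lra. }
  destruct (Hge y) as [|Ey]; [lra|assumption|exfalso].
  assert (Heq : forall t, x < t < y -> th t = IZR j * PI).
  { intros t Ht'. destruct (Hge t) as [Hlt|]; [lra| |auto]. exfalso.
    (* If the angle is above the level at t, it still is at y. *)
    set (tau := Rmin (margin r) (th t - IZR j * PI)).
    assert (T1 : tau <= margin r) by apply Rmin_l.
    assert (T2 : tau <= th t - IZR j * PI) by apply Rmin_r.
    assert (T3 : 0 < tau) by (apply Rmin_glb_lt; lra).
    assert (A : IZR j * PI + tau <= th y); [|lra].
    apply (crosses_upward r th j tau t y); auto; try lra.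
    rewrite Rabs_pos_eq; lra. }
  set (t := (x + y) / 2). assert (Ht' : x < t < y) by (unfold t; lra).
  destruct Ht as (Ct & _ & Dt).
  assert (D1 := Dt t ltac:(lra)).
  assert (E : flux r t (th t) = 0).
  { apply (derive_eq_on_interval th (fun _ => IZR j * PI) _ _ x y t Ht' Heq D1).
    apply @is_derive_const. }
  assert (P : 0 < flux r t (th t)); [|lra].
  apply (flux_pos_near_level r t _ j). rewrite Heq, Rminus_diag, Rabs_R0; lra.
Qed.

(** For r = 0 the flux at PI / 2 is - l < 0, so PI / 2 is a barrier.  This is where
    the sign of L and of the boundary constants puts the eigenvalues above 0. *)
Lemma angle_zero_end (th : R -> R) : gam <= PI / 2 -> angle 0 th -> th b <= PI / 2.
Proof.
  intros Hg (Ct & At & Dt).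
  enough (0 <= PI / 2 - th b) by lra.
  apply (nonneg_propagates (fun t => PI / 2 - th t)
           (fun t => - flux 0 t (th t)) a b 1 (rate 0)); try lra.
  - intros t _. apply continuity_pt_minus; [|apply Ct]. apply continuity_pt_const. now intros ? ?.
  - intros t Ht. evar_last.
    + apply @is_derive_minus; [apply @is_derive_const|apply Dt; lra].
    + apply Rminus_0_l.
  - intros t Ht Hd. assert (HL := flux_lipschitz 0 t (th t) (PI / 2)).
    rewrite (Rabs_pos_eq (th t - PI / 2)) in HL by lra.
    assert (E : flux 0 t (PI / 2) = - l t)
      by (unfold flux, potential; rewrite sin_PI2, cos_PI2; ring).
    rewrite E in HL. destruct (lbd t). apply Rabs_le_between in HL. lra.
Qed.

(** * Solutions in polar form *)

Definition sl_solution (r : R) (v p : R -> R) : Prop :=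
  continuity v /\ continuity p /\
  forall x, a < x < b ->
    is_derive v x (k x * p x) /\ is_derive p x (- potential r x * v x).

(** The components of (v, p) across and along the direction (sin th, cos th).  The
    flux is the angular velocity for which the first one satisfies a homogeneous
    linear equation by itself. *)
Lemma rotated_derive (r : R) (v p th : R -> R) (x : R) :
  sl_solution r v p -> angle r th -> a < x < b ->
  is_derive (fun y => v y * cos (th y) - p y * sin (th y)) x
    ((potential r x - k x) * (sin (th x) * cos (th x))
     * (v x * cos (th x) - p x * sin (th x))) /\
  is_derive (fun y => v y * sin (th y) + p y * cos (th y)) x
    ((k x - potential r x) * (sin (th x) * cos (th x))
     * (v x * sin (th x) + p x * cos (th x))
     + (k x * (cos (th x) * cos (th x)) + potential r x * (sin (th x) * sin (th x))
        - k x * (sin (th x) * sin (th x)) - potential r x * (cos (th x) * cos (th x)))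
     * (v x * cos (th x) - p x * sin (th x))).
Proof.
  intros (_ & _ & Ds) (_ & _ & Dt) Hx.
  destruct (Ds x Hx) as [D1 D2]. assert (D3 := Dt x Hx).
  assert (Dsin := is_derive_sin_comp th x _ D3).
  assert (Dcos := is_derive_cos_comp th x _ D3).
  assert (T := sin_cos_sqr (th x)).
  split.
  - evar_last.
    + apply @is_derive_minus; apply @is_derive_mult; eauto; intros; apply Rmult_comm.
    + unfold minus, plus, opp, mult, flux; simpl.
      set (s := sin (th x)) in *. set (co := cos (th x)) in *.
      apply Rminus_diag_uniq.
      replace (_ - _) with
        ((1 - (s * s + co * co)) * (k x * p x * co + potential r x * v x * s)
         ) by ring. rewrite T. ring.
  - evar_last.
    + apply @is_derive_plus; apply @is_derive_mult; eauto; intros; apply Rmult_comm.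
    + unfold minus, plus, opp, mult, flux; simpl.
      set (s := sin (th x)) in *. set (co := cos (th x)) in *.
      apply Rminus_diag_uniq.
      replace (_ - _) with
        ((1 - (s * s + co * co)) * (k x * p x * s - potential r x * v x * co)
         ) by ring. rewrite T. ring.
Qed.

(** The component of (v, p) across (sin th, cos th) vanishes at a by the boundary
    condition, hence everywhere.  The component along it, rad, then satisfies a
    homogeneous linear equation too, so it vanishes nowhere unless it is zero. *)
Lemma pruefer_representation (r : R) (v p th : R -> R) :
  sl_solution r v p -> angle r th ->
  cos gam * v a = sin gam * p a ->
  (exists x, a <= x <= b /\ v x <> 0) ->
  exists rad : R -> R,
    continuity rad /\
    forall x, a <= x <= b ->
      rad x <> 0 /\ v x = rad x * sin (th x) /\ p x = rad x * cos (th x).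
Proof.
  intros Hs Ht Hbc (x0 & Hx0 & Hnz).
  assert (Hrot := fun x => rotated_derive r v p th x Hs Ht).
  destruct Hs as (Cv & Cp & _). destruct Ht as (Ct & At & _).
  assert (Ccos := continuity_cos_comp th Ct).
  assert (Csin := continuity_sin_comp th Ct).
  set (s := fun y => v y * cos (th y) - p y * sin (th y)).
  set (rad := fun y => v y * sin (th y) + p y * cos (th y)).
  assert (Cs : continuity s).
  { intros x. apply continuity_pt_minus; apply continuity_pt_mult; auto. }
  assert (Cr : continuity rad).
  { intros x. apply continuity_pt_plus; apply continuity_pt_mult; auto. }
  assert (Hbd : forall q x y, Rabs q <= rate r ->
            Rabs (q * (sin (th x) * cos (th x)) * y) <= rate r * Rabs y).
  { intros q x y Hq. rewrite !Rabs_mult. apply Rmult_le_compat_r; [apply Rabs_pos|].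
    rewrite <- (Rmult_1_r (rate r)).
    apply Rmult_le_compat; try apply Rmult_le_pos; try apply Rabs_pos; auto.
    rewrite <- Rabs_mult. apply Rabs_sin_cos. }
  assert (Hs0 : forall x, a <= x <= b -> s x = 0).
  { apply (linear_growth_zero s
             (fun x => (potential r x - k x) * (sin (th x) * cos (th x)) * s x) a b (rate r) a).
    - intros; apply Cs.
    - intros x Hx. split; [apply Hrot, Hx|]. apply Hbd.
      rewrite Rabs_minus_sym. apply coefficient_gap.
    - lra.
    - unfold s. rewrite At. lra. }
  assert (Hrep : forall x, a <= x <= b -> v x = rad x * sin (th x) /\ p x = rad x * cos (th x)).
  { intros x Hx. specialize (Hs0 x Hx). unfold s in Hs0. unfold rad.
    assert (T := sin_cos_sqr (th x)).
    split; apply Rminus_diag_uniq.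
    - replace (_ - _) with (v x * (1 - (sin (th x) * sin (th x) + cos (th x) * cos (th x)))
        + (v x * cos (th x) - p x * sin (th x)) * cos (th x)) by ring.
      rewrite Hs0, T. ring.
    - replace (_ - _) with (p x * (1 - (sin (th x) * sin (th x) + cos (th x) * cos (th x)))
        - (v x * cos (th x) - p x * sin (th x)) * sin (th x)) by ring.
      rewrite Hs0, T. ring. }
  exists rad. split; [exact Cr|]. intros x Hx. split; [|now apply Hrep].
  intros Hz. apply Hnz. destruct (Hrep x0 Hx0) as [-> _].
  rewrite (linear_growth_zero rad
             (fun x => (k x - potential r x) * (sin (th x) * cos (th x)) * rad x)
             a b (rate r) x); auto; [ring|].
  intros y Hy. split; [|apply Hbd, coefficient_gap].
  destruct (Hrot y Hy) as [_ D]. specialize (Hs0 y ltac:(lra)). unfold s in Hs0.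
  rewrite Hs0, Rmult_0_r, Rplus_0_r in D. exact D.
Qed.

(** The amplitude has logarithmic derivative (k - potential) sin th cos th. *)
Lemma pruefer_solution (r : R) (th : R -> R) :
  angle r th ->
  exists rad : R -> R,
    (forall x, rad x <> 0) /\
    sl_solution r (fun x => rad x * sin (th x)) (fun x => rad x * cos (th x)).
Proof.
  intros (Ct & At & Dt).
  assert (Ccos := continuity_cos_comp th Ct).
  assert (Csin := continuity_sin_comp th Ct).
  set (q := fun x => (k x - potential r x) * (sin (th x) * cos (th x))).
  assert (Cq : continuity q).
  { intros x. apply continuity_pt_mult; [|apply continuity_pt_mult; auto].
    apply continuity_pt_minus; [apply kcont|apply potential_continuity]. }
  set (rad := fun x => exp (RInt q a x)).
  assert (Drad : forall x, is_derive rad x (q x * rad x)).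
  { intros x. apply (is_derive_comp exp (fun y => RInt q a y) x (rad x) (q x)).
    - unfold rad. auto_derive; auto. ring.
    - now apply is_derive_primitive. }
  exists rad. split.
  { intros x. apply Rgt_not_eq, exp_pos. }
  assert (Crad : continuity rad).
  { intros x. eapply is_derive_continuity_pt, Drad. }
  split; [intros x; apply continuity_pt_mult; auto|].
  split; [intros x; apply continuity_pt_mult; auto|].
  intros x Hx. assert (D3 := Dt x Hx).
  assert (Dsin := is_derive_sin_comp th x _ D3).
  assert (Dcos := is_derive_cos_comp th x _ D3).
  assert (T := sin_cos_sqr (th x)).
  split.
  - evar_last.
    + apply @is_derive_mult; eauto; intros; apply Rmult_comm.
    + unfold q, plus, mult, flux; simpl.
      set (s := sin (th x)) in *. set (co := cos (th x)) in *.
      apply Rminus_diag_uniq.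
      replace (_ - _) with (((s * s + co * co) - 1) * (k x * rad x * co)) by ring.
      rewrite T. ring.
  - evar_last.
    + apply @is_derive_mult; eauto; intros; apply Rmult_comm.
    + unfold q, plus, mult, flux; simpl.
      set (s := sin (th x)) in *. set (co := cos (th x)) in *.
      apply Rminus_diag_uniq.
      replace (_ - _) with ((1 - (s * s + co * co)) * (potential r x * rad x * s)) by ring.
      rewrite T. ring.
Qed.

(** * Modes and their numbering *)

Variable del : R.
Hypothesis gam_range : 0 <= gam <= PI / 2.
Hypothesis del_range : PI / 2 <= del <= PI.

Definition left_cond (v p : R -> R) : Prop := cos gam * v a = sin gam * p a.

Definition right_cond (v p : R -> R) : Prop := cos del * v b = sin del * p b.

(** An eigenfunction v together with its flux p = K v'. *)
Definition mode (r : R) (v p : R -> R) : Prop :=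
  sl_solution r v p /\ left_cond v p /\ right_cond v p /\
  exists x, a <= x <= b /\ v x <> 0.

Lemma angle_pos (r : R) (th : R -> R) (x : R) : angle r th -> a < x <= b -> 0 < th x.
Proof.
  intros Ht Hx. assert (A : IZR 0 * PI < th x); [|lra].
  apply (crosses_strictly r th 0 a x Ht); try lra.
  destruct Ht as (_ & -> & _). lra.
Qed.

Lemma mode_end_angle (r : R) (v p : R -> R) :
  mode r v p -> exists N : nat, theta r b = del + INR N * PI.
Proof.
  intros (Hs & Hl & Hr & Hnz).
  destruct (pruefer_representation r v p (theta r) Hs (theta_angle r) Hl Hnz) as (rad & _ & Hrep).
  destruct (Hrep b ltac:(lra)) as (R0 & Ev & Ep).
  unfold right_cond in Hr. rewrite Ev, Ep in Hr.
  assert (S : sin (theta r b - del) = 0).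
  { rewrite sin_minus. apply (Rmult_eq_reg_l (rad b)); [|exact R0]. lra. }
  apply sin_eq_0_0 in S as [j Hj].
  assert (P := angle_pos r _ b (theta_angle r) ltac:(lra)).
  assert (HP := PI_RGT_0).
  assert (Hj0 : (0 <= j)%Z).
  { apply Z.lt_succ_r, lt_IZR. rewrite succ_IZR. nra. }
  exists (Z.to_nat j). rewrite INR_IZR_INZ, Z2Nat.id by assumption. lra.
Qed.

Lemma mode_of_end_angle (r : R) (N : nat) :
  theta r b = del + INR N * PI -> exists v p, mode r v p.
Proof.
  intros HN.
  destruct (pruefer_solution r (theta r) (theta_angle r)) as (rad & Hrad & Hs).
  destruct (theta_angle r) as (Ct & At & Dt).
  exists (fun x => rad x * sin (theta r x)), (fun x => rad x * cos (theta r x)).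
  split; [exact Hs|]. split; [|split].
  - unfold left_cond. rewrite At. ring.
  - unfold right_cond. apply Rminus_diag_uniq.
    replace (_ - _) with (rad b * sin (theta r b - del)) by (rewrite sin_minus; ring).
    rewrite HN, INR_IZR_INZ.
    replace (del + IZR (Z.of_nat N) * PI - del) with (IZR (Z.of_nat N) * PI) by ring.
    rewrite sin_level. ring.
  - destruct (angle_leaves_levels r _ (theta_angle r)) as (x & Hx & Hsin).
    exists x. split; [lra|]. now apply Rmult_integral_contrapositive.
Qed.

(** Let N be the index of the final angle at rho j.  By strict monotonicity in r the
    index increases with j, so N >= j.  If N > j, the intermediate value theorem
    between 0 and rho j produces an eigenvalue with index j, which cannot be any of
    the rho i: for i < j the index is i, and for i >= j it is at least N. *)
Lemma eigenvalue_index (rho : nat -> R) :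
  (forall i j, (i < j)%nat -> rho i < rho j) ->
  (forall r, (exists v p, mode r v p) <-> exists j, r = rho j) ->
  forall j, theta (rho j) b = del + INR j * PI.
Proof.
  intros Hinc Hrho. assert (HP := PI_RGT_0).
  assert (Hlev : forall i N, theta (rho i) b = del + INR N * PI ->
            forall j M, theta (rho j) b = del + INR M * PI ->
            (i < j)%nat -> (N < M)%nat).
  { intros i N Hi j M Hj Hij. apply INR_lt. apply (Rmult_lt_reg_r PI); [exact HP|].
    assert (A := angle_strictly_monotone _ _ _ _ (theta_angle (rho i)) (theta_angle (rho j))
                   (Hinc i j Hij)).
    lra. }
  intros j. induction j as [j IH] using lt_wf_ind.
  destruct (proj2 (Hrho (rho j)) (ex_intro _ j eq_refl)) as (v & p & Hmode).
  destruct (mode_end_angle _ _ _ Hmode) as [N HN].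
  enough (N = j) as <- by exact HN.
  assert (Hge : (j <= N)%nat).
  { destruct j as [|j]; [lia|].
    assert (A := Hlev j j (IH j (Nat.lt_succ_diag_r j)) (S j) N HN (Nat.lt_succ_diag_r j)). lia. }
  destruct (Nat.eq_dec N j) as [|Hne]; [assumption|exfalso].
  assert (Hz := angle_zero_end _ (proj2 gam_range) (theta_angle 0)).
  assert (HNp : 0 <= INR N * PI) by (apply Rmult_le_pos; [apply pos_INR|lra]).
  assert (Hpos : 0 <= rho j).
  { destruct (Rle_lt_dec 0 (rho j)) as [|Hneg]; [assumption|exfalso].
    assert (A := angle_strictly_monotone _ _ _ _ (theta_angle (rho j)) (theta_angle 0) Hneg).
    lra. }
  assert (HK : INR j * PI <= INR N * PI).
  { apply Rmult_le_compat_r; [lra|]. now apply le_INR. }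
  assert (HK0 : 0 <= INR j * PI) by (apply Rmult_le_pos; [apply pos_INR|lra]).
  destruct (IVT_gen (fun r => theta r b) 0 (rho j) (del + INR j * PI)) as (r & _ & Hr).
  - apply theta_end_continuity.
  - rewrite Rmin_left, Rmax_right by lra. lra.
  - destruct (mode_of_end_angle r j Hr) as (v' & p' & Hmode').
    destruct (proj1 (Hrho r) (ex_intro _ v' (ex_intro _ p' Hmode'))) as (i & ->).
    assert (Hsame : forall M, theta (rho i) b = del + INR M * PI -> M = j).
    { intros M HM. apply INR_eq, (Rmult_eq_reg_r PI); lra. }
    destruct (Nat.lt_trichotomy i j) as [Hij|[->|Hij]].
    + assert (A := Hsame i (IH i Hij)). lia.
    + now apply Hne, Hsame.
    + assert (A := Hlev j N HN i j Hr Hij). lia.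
Qed.

(** * Combinations close to one mode *)

Definition zeros_in_order (f : R -> R) (N : nat) (x : nat -> R) : Prop :=
  (forall i, (i < N)%nat -> a < x i < b /\ f (x i) = 0) /\
  (forall i, (S i < N)%nat -> x i < x (S i)).

(** Lower bounds for the number of zeros; the enumeration need not be complete. *)
Definition has_zeros (f : R -> R) (N : nat) : Prop := exists x, zeros_in_order f N x.

Lemma nonvanishing_same_sign (f : R -> R) (x y : R) :
  continuity f -> (forall t, a <= t <= b -> f t <> 0) ->
  a <= x <= b -> a <= y <= b -> 0 < f x * f y.
Proof.
  intros Cf Hnz Hx Hy.
  assert (Hxn := Hnz x Hx). assert (Hyn := Hnz y Hy).
  destruct (Rtotal_order 0 (f x * f y)) as [|[E|Hneg]]; [assumption| |exfalso].
  { symmetry in E. apply Rmult_integral in E. tauto. }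
  destruct (Rle_lt_dec x y) as [Hxy|Hxy].
  - destruct (IVT_cor f x y Cf Hxy) as (z & Hz & Ez); [lra|].
    apply (Hnz z); [lra|exact Ez].
  - destruct (IVT_cor f y x Cf) as (z & Hz & Ez); [lra|lra|].
    apply (Hnz z); [lra|exact Ez].
Qed.

(** The angle takes values in ]0, PI[, ]PI, 2 PI[, ..., ]N PI, (N + 1) PI[ at N + 1
    successive points, where v alternates in sign.  A perturbation smaller than v at
    these points alternates as well and vanishes between them. *)
Lemma nearby_has_zeros (r : R) (v p : R -> R) (N : nat) :
  mode r v p -> theta r b = del + INR N * PI ->
  exists eps, 0 < eps /\
    forall w, continuity w -> (forall x, a <= x <= b -> Rabs (w x - v x) <= eps) ->
    has_zeros w N.
Proof.
  intros (Hs & Hl & Hr & Hnz) HN.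
  assert (Ht := theta_angle r). set (th := theta r) in *.
  assert (HP := PI_RGT_0).
  destruct (pruefer_representation r v p th Hs Ht Hl Hnz) as (rad & Cr & Hrep).
  destruct (Nat.eq_dec N 0) as [->|HN0].
  { exists 1. split; [lra|]. intros w _ _. exists (fun _ => 0). split; intros i Hi; lia. }
  assert (HN1 : 1 <= INR N) by (apply (le_INR 1); lia).
  destruct (theta_angle r) as (Ct & At & Dt). fold th in Ct, At, Dt.
  assert (Hpts : forall i, (i < S N)%nat ->
            exists x, a < x < b /\ INR i * PI < th x < INR (S i) * PI).
  { intros i Hi. rewrite S_INR.
    assert (Hi0 := pos_INR i).
    assert (HiN : INR i <= INR N) by (apply le_INR; lia).
    assert (B1 : INR i * PI <= INR N * PI) by (apply Rmult_le_compat_r; lra).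
    assert (B2 : PI <= INR N * PI) by nra.
    assert (B3 : 0 <= INR i * PI) by (apply Rmult_le_pos; lra).
    (* A value strictly inside both the range of th and the i-th nodal range. *)
    set (lo := Rmax gam (INR i * PI)). set (hi := Rmin (th b) ((INR i + 1) * PI)).
    assert (L1 : gam <= lo) by apply Rmax_l. assert (L2 : INR i * PI <= lo) by apply Rmax_r.
    assert (U1 : hi <= th b) by apply Rmin_l.
    assert (U2 : hi <= (INR i + 1) * PI) by apply Rmin_r.
    assert (LU : lo < hi).
    { apply Rmax_lub_lt; apply Rmin_glb_lt; lra. }
    destruct (IVT_gen th a b ((lo + hi) / 2)) as (x & Hx & Ex).
    - exact Ct.
    - rewrite At, Rmin_left, Rmax_right by lra. lra.
    - rewrite Rmin_left, Rmax_right in Hx by lra.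
      exists x. split; [|rewrite Ex; lra].
      split.
      + destruct (proj1 Hx) as [|Ea]; [assumption|]. rewrite <- Ea, At in Ex. lra.
      + destruct (proj2 Hx) as [|Eb]; [assumption|]. rewrite Eb in Ex. lra. }
  destruct (finite_choice _ _ Hpts) as [y Hy]. clear Hpts.
  assert (Hord : forall i, (S i < S N)%nat -> y i < y (S i)).
  { intros i Hi. destruct (Rlt_le_dec (y i) (y (S i))) as [|Hle]; [assumption|exfalso].
    destruct (Hy i ltac:(lia)) as (Yi & Li). destruct (Hy (S i) Hi) as (Ysi & Lsi).
    assert (A : IZR (Z.of_nat (S i)) * PI + 0 <= th (y i)).
    { apply (crosses_upward r th (Z.of_nat (S i)) 0 (y (S i)) (y i)); auto; try lra.
      - rewrite Rabs_R0. apply Rlt_le, margin_pos.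
      - rewrite <- INR_IZR_INZ. lra. }
    rewrite <- INR_IZR_INZ in A. lra. }
  assert (Hsin : forall i, (i < S N)%nat -> 0 < sin (th (y i) - IZR (Z.of_nat i) * PI)).
  { intros i Hi. destruct (Hy i Hi) as (_ & Li). rewrite <- INR_IZR_INZ.
    rewrite S_INR in Li. apply sin_gt_0; lra. }
  assert (Hvnz : forall i, (i < S N)%nat -> 0 < Rabs (v (y i))).
  { intros i Hi. apply Rabs_pos_lt. destruct (Hy i Hi) as (Yi & _).
    destruct (Hrep (y i) ltac:(lra)) as (R0 & -> & _).
    apply Rmult_integral_contrapositive. split; [exact R0|].
    rewrite (sin_shift_level _ (Z.of_nat i)). intros E.
    assert (S1 := Hsin i Hi). assert (S2 := cos_level_sqr (Z.of_nat i)).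
    apply Rmult_integral in E as [E|E]; [rewrite E in S2; lra|lra]. }
  assert (Halt : forall i, (S i < S N)%nat -> v (y i) * v (y (S i)) < 0).
  { intros i Hi. destruct (Hy i ltac:(lia)) as (Yi & _). destruct (Hy (S i) Hi) as (Ysi & _).
    destruct (Hrep (y i) ltac:(lra)) as (_ & -> & _).
    destruct (Hrep (y (S i)) ltac:(lra)) as (_ & -> & _).
    assert (Hrr : 0 < rad (y i) * rad (y (S i))).
    { apply nonvanishing_same_sign; auto; try lra. intros t Ht'. now apply Hrep. }
    rewrite (sin_shift_level (th (y i)) (Z.of_nat i)).
    rewrite (sin_shift_level (th (y (S i))) (Z.of_nat (S i))).
    assert (S1 := Hsin i ltac:(lia)). assert (S2 := Hsin (S i) Hi).
    assert (Q := cos_level_sqr (Z.of_nat i)).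
    assert (E : cos (IZR (Z.of_nat (S i)) * PI) = - cos (IZR (Z.of_nat i) * PI)).
    { rewrite <- !INR_IZR_INZ, S_INR, Rmult_plus_distr_r, Rmult_1_l. apply neg_cos. }
    rewrite E.
    set (s1 := sin (th (y i) - _)) in *. set (s2 := sin (th (y (S i)) - _)) in *.
    replace (_ * _) with
      (- ((cos (IZR (Z.of_nat i) * PI) * cos (IZR (Z.of_nat i) * PI))
          * (rad (y i) * rad (y (S i))) * (s1 * s2))) by ring.
    rewrite Q. assert (0 < s1 * s2) by (apply Rmult_lt_0_compat; assumption).
    assert (0 < rad (y i) * rad (y (S i)) * (s1 * s2)) by (apply Rmult_lt_0_compat; assumption).
    lra. }
  destruct (finite_pos_bound (fun i => Rabs (v (y i))) (S N) Hvnz) as (mu & Hmu & Hmin).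
  exists (mu / 2). split; [lra|]. intros w CZ HZ.
  assert (HZv : forall i, (i < S N)%nat -> 0 < w (y i) * v (y i)).
  { intros i Hi. destruct (Hy i Hi) as (Yi & _).
    assert (A := HZ (y i) ltac:(lra)). assert (B := Hmin i Hi). simpl in B.
    apply Rabs_le_between in A. unfold Rabs in B. destruct (Rcase_abs (v (y i))); nra. }
  assert (HZalt : forall i, (S i < S N)%nat -> w (y i) * w (y (S i)) < 0).
  { intros i Hi. assert (A := HZv i ltac:(lia)). assert (B := HZv (S i) Hi).
    assert (D := Halt i Hi).
    set (z1 := w (y i)) in *. set (z2 := w (y (S i))) in *.
    set (v1 := v (y i)) in *. set (v2 := v (y (S i))) in *.
    destruct (Rlt_le_dec (z1 * z2) 0) as [|Hge]; [assumption|exfalso].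
    assert (E : 0 < (z1 * v1) * (z2 * v2)) by (apply Rmult_lt_0_compat; assumption).
    replace ((z1 * v1) * (z2 * v2)) with ((z1 * z2) * (v1 * v2)) in E by ring. nra. }
  assert (Hroot : forall i, (i < N)%nat -> exists z, y i < z < y (S i) /\ w z = 0).
  { intros i Hi. assert (A := HZalt i ltac:(lia)). assert (O := Hord i ltac:(lia)).
    destruct (IVT_cor w (y i) (y (S i)) CZ) as (z & Hz & Ez); [lra|lra|].
    exists z. split; [|exact Ez]. split.
    - destruct (proj1 Hz) as [|Ea]; [assumption|]. rewrite Ea, Ez in A. lra.
    - destruct (proj2 Hz) as [|Ea]; [assumption|]. rewrite <- Ea, Ez in A. lra. }
  destruct (finite_choice _ _ Hroot) as [z Hz].
  exists z. split.
  - intros i Hi. destruct (Hz i Hi) as (A & B). split; [|exact B].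
    destruct (Hy i ltac:(lia)) as (Yi & _). destruct (Hy (S i) ltac:(lia)) as (Ysi & _). lra.
  - intros i Hi. destruct (Hz i ltac:(lia)) as (A & _). destruct (Hz (S i) Hi) as (B & _). lra.
Qed.

(** By Rolle's theorem q vanishes between two zeros of w.  But if both lie at the same
    level, the angle remains within eta of it in between, since it can only go up, and
    there |p| = |rad cos th| is too large for q to vanish. *)
Lemma one_zero_per_level (r eta eps c0 : R) (v p th rad w q : R -> R) (j : Z) (x y : R) :
  angle r th -> 0 < eta <= margin r ->
  (forall t, a <= t <= b -> c0 <= Rabs (rad t) /\ p t = rad t * cos (th t)) ->
  0 < c0 -> eps < c0 * cos eta ->
  continuity w -> (forall t, a < t < b -> is_derive w t (k t * q t)) ->
  (forall t, a <= t <= b -> Rabs (q t - p t) <= eps) ->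
  a <= x -> x < y -> y <= b -> w x = 0 -> w y = 0 ->
  Rabs (th x - IZR j * PI) < eta -> Rabs (th y - IZR j * PI) < eta -> False.
Proof.
  intros Ht He Hrad Hc0 Heps CZ DZ HP Hax Hxy Hyb Zx Zy Hx Hy.
  destruct (mvt_open w (fun t => k t * q t) x y Hxy) as (t & Htt & Et).
  { intros t Htt. apply DZ. lra. }
  { intros; apply CZ. }
  rewrite Zx, Zy, Rminus_diag in Et.
  assert (Pt : q t = 0).
  { symmetry in Et. apply Rmult_integral in Et as [Et|Et]; [|lra].
    destruct (kbd t). apply Rmult_integral in Et as [Et|Et]; lra. }
  apply Rabs_def2 in Hx. apply Rabs_def2 in Hy.
  assert (Hlo : IZR j * PI + (th x - IZR j * PI) <= th t).
  { apply (crosses_upward r th j _ x t); auto; try lra. apply Rabs_le_between. lra. }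
  assert (Hhi : th t <= IZR j * PI + eta).
  { destruct (Rle_lt_dec (th t) (IZR j * PI + eta)) as [|Hgt]; [assumption|exfalso].
    assert (A : IZR j * PI + eta <= th y).
    { apply (crosses_upward r th j eta t y); auto; try lra. rewrite Rabs_pos_eq; lra. }
    lra. }
  assert (HPI := PI_RGT_0). assert (Hm : margin r <= PI / 8) by apply Rmin_l.
  assert (Hcos : cos eta <= cos (th t - IZR j * PI)).
  { destruct (Rle_lt_dec 0 (th t - IZR j * PI)).
    - apply cos_decr_1; lra.
    - rewrite <- (cos_neg (th t - IZR j * PI)). apply cos_decr_1; lra. }
  destruct (Hrad t ltac:(lra)) as (Rt & Ept).
  assert (A := HP t ltac:(lra)). rewrite Pt, Rminus_0_l, Rabs_Ropp, Ept in A.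
  rewrite (cos_shift_level (th t) j), !Rabs_mult in A.
  assert (Hce : 0 < cos eta) by (apply cos_gt_0; lra).
  rewrite Rabs_cos_level, Rmult_1_l, (Rabs_pos_eq (cos (th t - _))) in A by lra.
  assert (B : c0 * cos eta <= Rabs (rad t) * cos (th t - IZR j * PI))
    by (apply Rmult_le_compat; lra).
  lra.
Qed.

Lemma continuous_nonvanishing_bound (f : R -> R) :
  continuity f -> (forall x, a <= x <= b -> f x <> 0) ->
  exists c0, 0 < c0 /\ forall x, a <= x <= b -> c0 <= Rabs (f x).
Proof.
  intros Cf Hnz.
  destruct (continuity_ab_min (fun x => Rabs (f x)) a b) as (x0 & Hmin & Hx0).
  - lra.
  - intros x _. apply (continuity_pt_comp f Rabs); [apply Cf|apply Rcontinuity_abs].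
  - exists (Rabs (f x0)). split; [now apply Rabs_pos_lt, Hnz|exact Hmin].
Qed.

(** Every zero of w lies close to a level, and each level has at most one of them.
    The levels 1, ..., N are available; levels 0 and N + 1 must be excluded.  If the
    condition at the end point in question is not the Dirichlet one, the angle keeps
    a distance eta from that level.  If it is, the end point itself is a zero of w at
    that level, and there is no room for another. *)
Lemma nearby_few_zeros (r : R) (v p : R -> R) (N : nat) :
  mode r v p -> theta r b = del + INR N * PI ->
  exists eps, 0 < eps /\
    forall w q, continuity w ->
      (forall x, a < x < b -> is_derive w x (k x * q x)) ->
      left_cond w q -> right_cond w q ->
      (forall x, a <= x <= b -> Rabs (w x - v x) <= eps /\ Rabs (q x - p x) <= eps) ->
      forall L, NoDup L -> (forall x, In x L -> a < x < b /\ w x = 0) -> (length L <= N)%nat.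
Proof.
  intros (Hs & Hl & Hr & Hnz) HN.
  assert (Ht := theta_angle r). set (th := theta r) in *.
  assert (HP := PI_RGT_0).
  destruct (pruefer_representation r v p th Hs Ht Hl Hnz) as (rad & Cr & Hrep).
  destruct (continuous_nonvanishing_bound rad Cr) as (c0 & Hc0 & Hrad).
  { intros x Hx. now apply Hrep. }
  assert (Hm := margin_pos r). assert (Hm8 : margin r <= PI / 8) by apply Rmin_l.
  assert (Heta : exists eta, 0 < eta <= margin r /\ (0 < gam -> eta <= gam)
                             /\ (del < PI -> eta <= PI - del)).
  { set (e1 := if Rlt_dec 0 gam then gam else PI).
    set (e2 := if Rlt_dec del PI then PI - del else PI).
    exists (Rmin (margin r) (Rmin e1 e2)).
    assert (A1 := Rmin_l (margin r) (Rmin e1 e2)). assert (A2 := Rmin_r (margin r) (Rmin e1 e2)).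
    assert (A3 := Rmin_l e1 e2). assert (A4 := Rmin_r e1 e2).
    unfold e1, e2 in *.
    destruct (Rlt_dec 0 gam); destruct (Rlt_dec del PI);
      (split; [split; [apply Rmin_glb_lt; [|apply Rmin_glb_lt]|]|split; intros]; lra). }
  destruct Heta as (eta & He & Heg & Hed).
  assert (Hse : 0 < sin eta) by (apply sin_gt_0; lra).
  assert (Hce : sin eta <= cos eta).
  { rewrite <- sin_shift. apply sin_incr_1; lra. }
  (* A zero of w then has |sin th| < sin eta, and since sin eta <= cos eta the
     same tolerance serves for the zero of q found by Rolle's theorem. *)
  exists (c0 * sin eta / 2).
  assert (Heps : 0 < c0 * sin eta) by (apply Rmult_lt_0_compat; assumption).
  split; [lra|].
  intros w q CZ DZ LZ RZ Hclose L HL HLz.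
  assert (Hone : forall j x y, a <= x -> x < y -> y <= b -> w x = 0 -> w y = 0 ->
            Rabs (th x - IZR j * PI) < eta -> Rabs (th y - IZR j * PI) < eta -> False).
  { intros j x y. apply (one_zero_per_level r eta (c0 * sin eta / 2) c0 v p th rad w q); auto.
    - intros t Htt. split; [now apply Hrad|now apply Hrep].
    - assert (c0 * sin eta <= c0 * cos eta) by (apply Rmult_le_compat_l; lra). lra.
    - intros t Htt. now apply Hclose. }
  assert (Hlev : forall x, a < x < b -> w x = 0 -> Rabs (th x - IZR (level (th x)) * PI) < eta).
  { intros x Hx Zx. apply small_sin_near_level; [lra|].
    destruct (Hclose x ltac:(lra)) as (A & _). destruct (Hrep x ltac:(lra)) as (_ & Ev & _).
    rewrite Zx, Rminus_0_l, Rabs_Ropp, Ev, Rabs_mult in A.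
    specialize (Hrad x ltac:(lra)).
    assert (B : c0 * Rabs (sin (th x)) <= Rabs (rad x) * Rabs (sin (th x)))
      by (apply Rmult_le_compat_r; [apply Rabs_pos|exact Hrad]).
    apply (Rmult_lt_reg_l c0); lra. }
  destruct (theta_angle r) as (Ct & At & Dt). fold th in Ct, At, Dt.
  assert (Hrange : forall x, a < x < b -> w x = 0 -> (1 <= level (th x) <= Z.of_nat N)%Z).
  { intros x Hx Zx. assert (A := Hlev x Hx Zx). set (j := level (th x)) in *.
    assert (Aj := A). apply Rabs_def2 in Aj.
    assert (Hpos : 0 < th x) by (apply (angle_pos r th x Ht); lra).
    assert (Hj0 : (0 <= j)%Z).
    { apply Z.lt_succ_r, lt_IZR. rewrite succ_IZR. nra. }
    assert (Hj0' : j <> 0%Z).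
    { intros Hj. rewrite Hj in A. destruct (Rle_lt_dec gam 0) as [Hg|Hg].
      - assert (Eg : gam = 0) by lra.
        apply (Hone 0%Z a x); try lra.
        + unfold left_cond in LZ. rewrite Eg, cos_0, sin_0 in LZ. lra.
        + rewrite At, Eg, Rmult_0_l, Rminus_diag, Rabs_R0. lra.
      - specialize (Heg Hg).
        assert (B : IZR 0 * PI + eta <= th x).
        { apply (crosses_upward r th 0 eta a x); auto; try lra. rewrite Rabs_pos_eq; lra. }
        apply Rabs_def2 in A. lra. }
    assert (Hend : th b = del + IZR (Z.of_nat N) * PI) by (rewrite <- INR_IZR_INZ; exact HN).
    assert (Hlt : th x < IZR (Z.of_nat N + 1) * PI).
    { destruct (Rlt_le_dec (th x) (IZR (Z.of_nat N + 1) * PI)) as [|Hge]; [assumption|exfalso].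
      assert (B := crosses_strictly r th _ x b Ht ltac:(lra) ltac:(lra) ltac:(lra) Hge).
      rewrite plus_IZR in B. lra. }
    assert (Hj1 : (j < Z.of_nat N + 2)%Z).
    { apply lt_IZR. rewrite plus_IZR in *. nra. }
    assert (Hj1' : j <> (Z.of_nat N + 1)%Z).
    { intros Hj. rewrite Hj in A, Aj. rewrite plus_IZR in *.
      destruct (Rlt_le_dec del PI) as [Hd|Hd].
      - specialize (Hed Hd).
        assert (B : IZR (Z.of_nat N + 1) * PI + (th x - IZR (Z.of_nat N + 1) * PI) <= th b).
        { apply (crosses_upward r th _ _ x b); auto; try lra.
          rewrite plus_IZR. apply Rlt_le. lra. }
        rewrite plus_IZR in B. lra.
      - assert (Eg : del = PI) by lra.
        apply (Hone (Z.of_nat N + 1)%Z x b); try lra.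
        + unfold right_cond in RZ. rewrite Eg, cos_PI, sin_PI in RZ. lra.
        + rewrite plus_IZR. exact A.
        + rewrite plus_IZR, Hend, Eg.
          replace (PI + IZR (Z.of_nat N) * PI - (IZR (Z.of_nat N) + 1) * PI) with 0 by ring.
          rewrite Rabs_R0. lra. }
    lia. }
  assert (Hinj : forall x y, In x L -> In y L -> level (th x) = level (th y) -> x = y).
  { intros x y Ix Iy E. destruct (HLz x Ix) as (Hx & Zx). destruct (HLz y Iy) as (Hy & Zy).
    assert (A := Hlev x Hx Zx). assert (B := Hlev y Hy Zy).
    destruct (Rtotal_order x y) as [Hxy|[Hxy|Hxy]]; [exfalso|exact Hxy|exfalso].
    - apply (Hone (level (th x)) x y); try lra. now rewrite E.
    - apply (Hone (level (th y)) y x); try lra. now rewrite <- E. }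
  assert (Hle : (length (map (fun x => level (th x)) L) <= length (map Z.of_nat (seq 1 N)))%nat).
  { apply NoDup_incl_length.
    - apply NoDup_map_NoDup_ForallPairs; [|exact HL]. intros x y Ix Iy. now apply Hinj.
    - intros z Hz. apply in_map_iff in Hz as (x & <- & Ix).
      destruct (HLz x Ix) as (Hx & Zx). assert (A := Hrange x Hx Zx).
      apply in_map_iff. exists (Z.to_nat (level (th x))). split; [lia|].
      apply in_seq. lia. }
  rewrite !length_map, length_seq in Hle. exact Hle.
Qed.

(** * Sturm's step *)

(** Two vectors parallel to (sin t, cos t) are parallel to each other. *)
Lemma wronskian_at_end (t v p v1 p1 : R) :
  cos t * v = sin t * p -> cos t * v1 = sin t * p1 -> p * v1 - v * p1 = 0.
Proof.
  intros H H1. assert (T := sin_cos_sqr t).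
  assert (E1 : v1 * (sin t * p) - v * (sin t * p1) = 0) by (rewrite <- H, <- H1; ring).
  assert (E2 : p * (cos t * v1) - p1 * (cos t * v) = 0) by (rewrite H, H1; ring).
  replace (p * v1 - v * p1) with
    ((sin t * sin t + cos t * cos t) * (p * v1 - v * p1)) by (rewrite T; ring).
  replace (_ * _) with
    (sin t * (v1 * (sin t * p) - v * (sin t * p1))
     + cos t * (p * (cos t * v1) - p1 * (cos t * v))) by ring.
  rewrite E1, E2. ring.
Qed.

(** The angle stays strictly between the levels 0 and 1. *)
Lemma first_mode_nonzero (r : R) (v p : R -> R) (x : R) :
  mode r v p -> theta r b = del -> a < x < b -> v x <> 0.
Proof.
  intros (Hs & Hl & Hr & Hnz) Hend Hx.
  assert (Ht := theta_angle r).
  destruct (pruefer_representation r v p _ Hs Ht Hl Hnz) as (rad & _ & Hrep).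
  destruct (Hrep x ltac:(lra)) as (R0 & -> & _).
  apply Rmult_integral_contrapositive. split; [exact R0|].
  apply Rgt_not_eq, sin_gt_0.
  - apply (angle_pos r); [exact Ht|lra].
  - destruct (Rlt_le_dec (theta r x) PI) as [|Hge]; [assumption|exfalso].
    assert (A : IZR 1 * PI < theta r b); [|lra].
    apply (crosses_strictly r _ 1 x b Ht); lra.
Qed.

(** From N zeros of y, Rolle's theorem for y / v1 gives N - 1 interior zeros of the
    Wronskian W = q v1 - y p1, and the boundary conditions add both end points.  Rolle's
    theorem for W then gives N zeros of W' = - g w v1, where g and v1 do not vanish. *)
Lemma sturm_step (r : R) (v1 p1 y q w : R -> R) (N : nat) :
  mode r v1 p1 -> theta r b = del ->
  continuity y -> continuity q ->
  (forall x, a < x < b ->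
    is_derive y x (k x * q x) /\
    is_derive q x (- potential r x * y x - g x * w x)) ->
  left_cond y q -> right_cond y q ->
  has_zeros y N -> has_zeros w N.
Proof.
  intros Hmode Hend Cy Cq Dy Ly Ry (x & Hx & Hord).
  assert (Hv1 := fun t => first_mode_nonzero r v1 p1 t Hmode Hend).
  destruct Hmode as ((Cv1 & Cp1 & D1) & L1 & R1 & _).
  destruct N as [|M].
  { exists (fun _ => 0). split; intros i Hi; lia. }
  set (W := fun t => q t * v1 t - y t * p1 t).
  assert (HWd : forall t, a < t < b -> is_derive W t (- (g t * w t * v1 t))).
  { intros t Ht. destruct (Dy t Ht) as (Dy1 & Dq1). destruct (D1 t Ht) as (Dv & Dp).
    unfold W. evar_last.
    - apply @is_derive_minus; apply @is_derive_mult; eauto; intros; apply Rmult_comm.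
    - unfold minus, plus, opp, mult; simpl. ring. }
  assert (HWc : continuity W).
  { intros t. apply continuity_pt_minus; apply continuity_pt_mult; auto. }
  assert (HWa : W a = 0) by (apply (wronskian_at_end gam); assumption).
  assert (HWb : W b = 0) by (apply (wronskian_at_end del); assumption).
  assert (Hmid : forall i, (i < M)%nat -> exists t, x i < t < x (S i) /\ W t = 0).
  { intros i Hi.
    destruct (Hx i ltac:(lia)) as (Xi & Yi). destruct (Hx (S i) ltac:(lia)) as (Xs & Ys).
    destruct (rolle_zero (fun t => y t / v1 t) (fun t => k t * W t / (v1 t * v1 t)) (x i) (x (S i)))
      as (t & Ht & E).
    - apply Hord. lia.
    - intros t Ht. assert (Ht' : a < t < b) by lra.
      destruct (Dy t Ht') as (Dy1 & _). destruct (D1 t Ht') as (Dv & _).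
      evar_last.
      + apply is_derive_div; eauto.
      + unfold W. field. now apply Hv1.
    - intros t Ht. apply continuity_pt_div; auto. apply Hv1. lra.
    - rewrite Yi. apply Rmult_0_l.
    - rewrite Ys. apply Rmult_0_l.
    - exists t. split; [exact Ht|]. destruct (kbd t).
      assert (V := Hv1 t ltac:(lra)).
      apply Rmult_integral in E as [E|E].
      + apply Rmult_integral in E as [E|E]; [lra|exact E].
      + exfalso. revert E. apply Rinv_neq_0_compat. now apply Rmult_integral_contrapositive. }
  destruct (finite_choice _ _ Hmid) as [s Hs].
  (* The zeros of W in order: both end points, and the zeros found above. *)
  set (e := fun i => match i with
                     | O => a
                     | S i' => if Nat.ltb i' M then s i' else b
                     end).
  assert (He : forall i, (i <= M)%nat ->
             a <= e i /\ e i < e (S i) /\ e (S i) <= b /\ W (e i) = 0 /\ W (e (S i)) = 0).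
  { intros i Hi.
    assert (Hes : e (S i) = if Nat.ltb i M then s i else b) by reflexivity.
    assert (Hei : (i = 0%nat /\ e i = a) \/
                  (exists i', i = S i' /\ (i' < M)%nat /\ e i = s i')).
    { destruct i as [|i']; [left; auto|right]. exists i'. split; [reflexivity|].
      split; [lia|]. unfold e. destruct (Nat.ltb_spec i' M); [reflexivity|lia]. }
    destruct (Nat.ltb_spec i M) as [Hlt|Hge]; rewrite Hes.
    - destruct (Hs i Hlt) as (Si & Wi). destruct (Hx i ltac:(lia)) as (Xi & _).
      destruct (Hx (S i) ltac:(lia)) as (Xs & _).
      destruct Hei as [[-> ->]|(i' & -> & Hi' & ->)].
      + repeat split; try lra; auto.
      + destruct (Hs i' Hi') as (Si' & Wi'). destruct (Hx i' ltac:(lia)) as (Xi' & _).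
        repeat split; try lra; auto.
    - destruct Hei as [[-> ->]|(i' & -> & Hi' & ->)].
      + repeat split; try lra; auto.
      + destruct (Hs i' Hi') as (Si' & Wi'). destruct (Hx i' ltac:(lia)) as (Xi' & _).
        destruct (Hx (S i') ltac:(lia)) as (Xs & _).
        repeat split; try lra; auto. }
  assert (Hend' : forall i, (i < S M)%nat -> exists z, e i < z < e (S i) /\ w z = 0).
  { intros i Hi. destruct (He i ltac:(lia)) as (E1 & E2 & E3 & E4 & E5).
    destruct (rolle_zero W (fun t => - (g t * w t * v1 t)) (e i) (e (S i))) as (z & Hz & Ez); auto.
    - intros t Ht. apply HWd. lra.
    - exists z. split; [exact Hz|]. destruct (gbd z).
      assert (V := Hv1 z ltac:(lra)).
      assert (E : g z * w z * v1 z = 0) by lra.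
      apply Rmult_integral in E as [E|E]; [|contradiction].
      apply Rmult_integral in E as [E|E]; [lra|exact E]. }
  destruct (finite_choice _ _ Hend') as [z Hz].
  exists z. split.
  - intros i Hi. destruct (He i ltac:(lia)) as (E1 & E2 & E3 & _).
    destruct (Hz i Hi) as (Hzi & Ezi). split; [lra|exact Ezi].
  - intros i Hi. destruct (Hz i ltac:(lia)) as (Hzi & _). destruct (Hz (S i) Hi) as (Hzs & _). lra.
Qed.

Lemma has_zeros_imp (f h : R -> R) (N : nat) :
  (forall x, f x = 0 -> h x = 0) -> has_zeros f N -> has_zeros h N.
Proof.
  intros H (x & Hx & Hord). exists x. split; [|exact Hord].
  intros i Hi. destruct (Hx i Hi) as (A & B). split; [exact A|apply H, B].
Qed.

Lemma has_zeros_scaled_comb (s : R) (B B' : nat -> R) (f : nat -> R -> R) (N M : nat) :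
  s <> 0 -> (forall j, (j < N)%nat -> B j = s * B' j) ->
  has_zeros (comb B f N) M <-> has_zeros (comb B' f N) M.
Proof.
  intros Hs HB.
  assert (E : forall x, comb B f N x = s * comb B' f N x).
  { intros x. rewrite <- comb_scale. now apply comb_ext. }
  split; apply has_zeros_imp; intros x Hx; rewrite E in *.
  - apply Rmult_integral in Hx as [Hx|Hx]; [contradiction|exact Hx].
  - rewrite Hx. ring.
Qed.

Lemma has_zeros_list (f : R -> R) (N : nat) :
  has_zeros f N ->
  exists L, NoDup L /\ length L = N /\ forall x, In x L -> a < x < b /\ f x = 0.
Proof.
  intros (x & Hx & Hord). exists (map x (seq 0 N)).
  assert (Hlt : forall i j, (i < j)%nat -> (j < N)%nat -> x i < x j).
  { intros i j Hij. induction Hij as [|j Hij IH]; intros Hj; [now apply Hord|].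
    apply Rlt_trans with (x j); [apply IH; lia|now apply Hord]. }
  split; [|split].
  - apply NoDup_map_NoDup_ForallPairs; [|apply seq_NoDup].
    intros i j Hi Hj E. apply in_seq in Hi, Hj.
    destruct (Nat.lt_trichotomy i j) as [H|[H|H]]; [exfalso|exact H|exfalso].
    + assert (A := Hlt i j H ltac:(lia)). lra.
    + assert (A := Hlt j i H ltac:(lia)). lra.
  - now rewrite length_map, length_seq.
  - intros y Hy. apply in_map_iff in Hy as (i & <- & Hi). apply in_seq in Hi.
    apply Hx. lia.
Qed.

Lemma list_has_zeros (f : R -> R) (L : list R) :
  NoDup L -> (forall x, In x L -> a < x < b /\ f x = 0) -> has_zeros f (length L).
Proof.
  intros HL Hz. destruct (sorted_enumeration L HL) as (x & Hx & Hord).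
  exists x. split; [|exact Hord]. intros i Hi. apply Hz, Hx, Hi.
Qed.

Lemma continuous_bound (f : R -> R) :
  continuity f -> exists S, 0 <= S /\ forall x, a <= x <= b -> Rabs (f x) <= S.
Proof.
  intros Cf.
  destruct (continuity_ab_maj (fun x => Rabs (f x)) a b) as (x0 & Hmax & _).
  - lra.
  - intros x _. apply (continuity_pt_comp f Rabs); [apply Cf|apply Rcontinuity_abs].
  - exists (Rabs (f x0)). split; [apply Rabs_pos|exact Hmax].
Qed.

Lemma finite_family_bound (f : nat -> R -> R) (N : nat) :
  (forall j, continuity (f j)) ->
  exists S, 0 <= S /\ forall j x, (j < N)%nat -> a <= x <= b -> Rabs (f j x) <= S.
Proof.
  intros Cf. induction N as [|N IH].
  - exists 0. split; [lra|]. intros j x Hj. lia.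
  - destruct IH as (S1 & H1 & B1). destruct (continuous_bound (f N) (Cf N)) as (S2 & H2 & B2).
    exists (S1 + S2). split; [lra|]. intros j x Hj Hx.
    destruct (Nat.eq_dec j N) as [->|].
    + specialize (B2 x Hx). lra.
    + specialize (B1 j x ltac:(lia) Hx). lra.
Qed.

(** * Counting the zeros of a combination *)

(* The family of all modes, numbered from 0 so that the j-th has j zeros. *)
Variables (rho : nat -> R) (v p : nat -> R -> R).
Hypothesis rho_increasing : forall i j, (i < j)%nat -> rho i < rho j.
Hypothesis modes : forall j, mode (rho j) (v j) (p j).
Hypothesis rho_index : forall j, theta (rho j) b = del + INR j * PI.

Lemma v_continuity (j : nat) : continuity (v j).
Proof. apply (modes j). Qed.

Lemma p_continuity (j : nat) : continuity (p j).
Proof. apply (modes j). Qed.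

Lemma comb_left (B : nat -> R) (N : nat) : left_cond (comb B v N) (comb B p N).
Proof.
  unfold left_cond. induction N as [|N IH]; simpl; [ring|].
  destruct (modes N) as (_ & E & _). unfold left_cond in E.
  rewrite !Rmult_plus_distr_l, IH.
  replace (cos gam * (B N * v N a)) with (B N * (cos gam * v N a)) by ring. rewrite E. ring.
Qed.

Lemma comb_right (B : nat -> R) (N : nat) : right_cond (comb B v N) (comb B p N).
Proof.
  unfold right_cond. induction N as [|N IH]; simpl; [ring|].
  destruct (modes N) as (_ & _ & E & _). unfold right_cond in E.
  rewrite !Rmult_plus_distr_l, IH.
  replace (cos del * (B N * v N b)) with (B N * (cos del * v N b)) by ring. rewrite E. ring.
Qed.

Lemma comb_derive_v (B : nat -> R) (N : nat) (x : R) :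
  a < x < b -> is_derive (comb B v N) x (k x * comb B p N x).
Proof.
  intros Hx. evar_last.
  - apply (comb_derive B v (fun j x => k x * p j x)). intros j. now apply (modes j).
  - induction N as [|N IH]; simpl; [ring|]. rewrite IH. ring.
Qed.

(** The part of the potential that depends on j is collected in the second sum, on
    which [sturm_step] acts. *)
Lemma comb_derive_p (B : nat -> R) (N : nat) (x : R) :
  a < x < b ->
  is_derive (comb B p N) x
    (- potential (rho 0) x * comb B v N x
     - g x * comb (fun j => (rho j - rho 0) * B j) v N x).
Proof.
  intros Hx. evar_last.
  - apply (comb_derive B p (fun j x => - potential (rho j) x * v j x)).
    intros j. now apply (modes j).
  - induction N as [|N IH]; simpl; [ring|]. rewrite IH. unfold potential. ring.
Qed.

Lemma comb_step (B : nat -> R) (N M : nat) :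
  has_zeros (comb B v N) M -> has_zeros (comb (fun j => (rho j - rho 0) * B j) v N) M.
Proof.
  apply (sturm_step (rho 0) (v 0%nat) (p 0%nat) _ (comb B p N)).
  - apply modes.
  - rewrite rho_index. simpl. ring.
  - apply comb_continuity, v_continuity.
  - apply comb_continuity, p_continuity.
  - intros x Hx. split; [now apply comb_derive_v|now apply comb_derive_p].
  - apply comb_left.
  - apply comb_right.
Qed.

Lemma comb_steps (B : nat -> R) (N M T : nat) :
  has_zeros (comb B v N) M -> has_zeros (comb (fun j => (rho j - rho 0) ^ T * B j) v N) M.
Proof.
  induction T as [|T IH]; intros H.
  - apply (has_zeros_scaled_comb 1 _ B); [lra| |exact H]. intros j _. simpl. ring.
  - apply IH, comb_step in H. revert H.
    apply (has_zeros_scaled_comb 1); [lra|]. intros j _. simpl. ring.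
Qed.

(** The fluxes are controlled as well because [nearby_few_zeros] needs both. *)
Lemma near_single_tolerance (N q : nat) (eps : R) :
  0 < eps -> (q < N)%nat ->
  exists e, 0 < e /\ forall B, (forall j, (j < N)%nat -> Rabs (B j - delta q j) <= e) ->
    forall x, a <= x <= b ->
      Rabs (comb B v N x - v q x) <= eps /\ Rabs (comb B p N x - p q x) <= eps.
Proof.
  intros He Hq.
  destruct (finite_family_bound v N v_continuity) as (S1 & P1 & B1).
  destruct (finite_family_bound p N p_continuity) as (S2 & P2 & B2).
  assert (HN := pos_INR N).
  assert (Hd : 0 < INR N * (S1 + S2) + 1).
  { assert (0 <= INR N * (S1 + S2)) by (apply Rmult_le_pos; lra). lra. }
  set (e := eps / (INR N * (S1 + S2) + 1)).
  assert (Hepos : 0 < e) by (apply Rdiv_lt_0_compat; lra).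
  assert (Hsmall : INR N * (e * (S1 + S2)) <= eps).
  { replace eps with (e * (INR N * (S1 + S2) + 1)) at 1 by (unfold e; field; lra). lra. }
  assert (Hpart : forall S', S' <= S1 + S2 -> INR N * (e * S') <= eps).
  { intros S' HS. eapply Rle_trans; [|exact Hsmall].
    apply Rmult_le_compat_l; [lra|]. apply Rmult_le_compat_l; lra. }
  exists e. split; [exact Hepos|]. intros B HB x Hx. split.
  - eapply Rle_trans; [|apply (Hpart S1); lra]. apply comb_near_single; auto.
  - eapply Rle_trans; [|apply (Hpart S2); lra]. apply comb_near_single; auto.
Qed.

(** After T steps the coefficients are lam j ^ T * A j with lam j = rho j - rho 0,
    increasing in j, so the last non-zero one dominates. *)
Lemma zeros_at_most (A : nat -> R) (N q M : nat) :
  (q < N)%nat -> A q <> 0 -> (forall j, (q < j)%nat -> (j < N)%nat -> A j = 0) ->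
  has_zeros (comb A v N) M -> (M <= q)%nat.
Proof.
  intros Hq HAq Hlast HM.
  destruct (nearby_few_zeros _ _ _ q (modes q) (rho_index q)) as (eps & He & Hfew).
  destruct (near_single_tolerance N q eps He Hq) as (e & Hepos & Hnear).
  set (lam := fun j => rho j - rho 0%nat).
  assert (Hlam : forall i j, (i < j)%nat -> lam i < lam j).
  { intros i j Hij. unfold lam. assert (B := rho_increasing i j Hij). lra. }
  assert (Hlam0 : lam 0%nat = 0) by apply Rminus_diag.
  assert (HT : exists T, lam q ^ T <> 0 /\ forall j, (j < N)%nat ->
             Rabs (lam j ^ T * A j / (lam q ^ T * A q) - delta q j) <= e).
  { destruct (Nat.eq_dec q 0) as [->|Hq0].
    (* If q = 0 the multiplier of the pivot is zero, but A already is a multiple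
       of delta 0. *)
    - exists 0%nat. simpl. split; [lra|]. intros j Hj. unfold delta.
      destruct (Nat.eq_dec j 0) as [->|Hj0].
      + replace (_ - 1) with 0 by (field; exact HAq). rewrite Rabs_R0. lra.
      + rewrite (Hlast j) by lia.
        replace (_ - 0) with 0 by (field; exact HAq). rewrite Rabs_R0. lra.
    - assert (Hlq : 0 < lam q) by (rewrite <- Hlam0; apply Hlam; lia).
      destruct (powers_vanish (fun j => lam j / lam q)
                  (fun j => if Nat.eq_dec j q then 0 else A j / A q) N e Hepos) as (T & HT).
      + intros j Hj. destruct (Nat.eq_dec j q) as [|Hne]; [now left|].
        destruct (Nat.lt_ge_cases j q) as [Hjq|Hjq].
        * right. assert (0 <= lam j).
          { destruct j; [rewrite Hlam0; lra|]. rewrite <- Hlam0. apply Rlt_le, Hlam. lia. }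
          assert (L := Hlam j q Hjq).
          rewrite Rabs_pos_eq by (apply Rdiv_le_0_compat; lra).
          apply (Rmult_lt_reg_r (lam q)); [exact Hlq|].
          replace (lam j / lam q * lam q) with (lam j) by (field; lra). lra.
        * left. rewrite (Hlast j) by lia. unfold Rdiv. ring.
      + assert (Hpq : lam q ^ T <> 0) by (apply pow_nonzero; lra).
        exists T. split; [exact Hpq|]. intros j Hj. specialize (HT T (le_n T) j Hj).
        unfold delta. destruct (Nat.eq_dec j q) as [->|Hne].
        * replace (_ - 1) with 0 by (field; split; assumption). rewrite Rabs_R0. lra.
        * rewrite pow_div_distr in HT.
          replace (_ - 0) with (lam j ^ T / lam q ^ T * (A j / A q))
            by (field; split; assumption). exact HT. }
  destruct HT as (T & HTq & HT).
  apply (comb_steps A N M T) in HM.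
  set (B := fun j => lam j ^ T * A j / (lam q ^ T * A q)) in HT.
  apply (has_zeros_scaled_comb (lam q ^ T * A q) _ B) in HM.
  - destruct (has_zeros_list _ _ HM) as (L & HL & <- & HLz).
    apply (Hfew (comb B v N) (comb B p N)); auto.
    + apply comb_continuity, v_continuity.
    + intros x Hx. now apply comb_derive_v.
    + apply comb_left.
    + apply comb_right.
  - now apply Rmult_integral_contrapositive.
  - intros j Hj. fold (lam j). unfold B. field. split; assumption.
Qed.

(** Dividing the coefficients by lam j ^ T, with lam j = rho j - rho 0, makes the first
    non-zero one dominate.  The resulting combination has q zeros, and T steps lead
    from it back to a multiple of the given one. *)
Lemma zeros_at_least (A : nat -> R) (N q : nat) :
  (q < N)%nat -> A q <> 0 -> (forall j, (j < q)%nat -> A j = 0) ->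
  has_zeros (comb A v N) q.
Proof.
  intros Hq HAq Hfirst.
  destruct (Nat.eq_dec q 0) as [->|Hq0].
  { exists (fun _ => 0). split; intros i Hi; lia. }
  destruct (nearby_has_zeros _ _ _ q (modes q) (rho_index q)) as (eps & He & Hmany).
  destruct (near_single_tolerance N q eps He Hq) as (e & Hepos & Hnear).
  set (lam := fun j => rho j - rho 0%nat).
  assert (Hlam : forall i j, (i < j)%nat -> lam i < lam j).
  { intros i j Hij. unfold lam. assert (B := rho_increasing i j Hij). lra. }
  assert (Hlq : 0 < lam q).
  { replace 0 with (lam 0%nat) by apply Rminus_diag. apply Hlam. lia. }
  destruct (powers_vanish (fun j => lam q / lam j)
              (fun j => if Nat.eq_dec j q then 0 else A j / A q) N e Hepos) as (T & HT).
  { intros j Hj. destruct (Nat.eq_dec j q) as [|Hne]; [now left|].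
    destruct (Nat.lt_ge_cases j q) as [Hjq|Hjq].
    - left. rewrite (Hfirst j) by lia. unfold Rdiv. ring.
    - right. assert (L := Hlam q j ltac:(lia)).
      rewrite Rabs_pos_eq by (apply Rdiv_le_0_compat; lra).
      apply (Rmult_lt_reg_r (lam j)); [lra|].
      replace (lam q / lam j * lam j) with (lam q) by (field; lra). lra. }
  specialize (HT T (le_n T)).
  (* For j < q the multiplier lam j may be zero; there A j = 0. *)
  set (B := fun j => (lam q / lam j) ^ T * (A j / A q)).
  assert (HB : has_zeros (comb B v N) q).
  { apply Hmany; [apply comb_continuity, v_continuity|].
    intros x Hx. apply Hnear; [|exact Hx].
    intros j Hj. specialize (HT j Hj). unfold B, delta.
    destruct (Nat.eq_dec j q) as [->|Hne].
    - replace (lam q / lam q) with 1 by (field; lra). rewrite pow1.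
      replace (_ - 1) with 0 by (field; assumption). rewrite Rabs_R0. lra.
    - rewrite Rminus_0_r. exact HT. }
  apply (comb_steps B N q T) in HB. revert HB.
  apply (has_zeros_scaled_comb (A q / lam q ^ T)).
  - apply Rmult_integral_contrapositive. split; [exact HAq|].
    apply Rinv_neq_0_compat, pow_nonzero. lra.
  - intros j Hj. fold (lam j). unfold B.
    destruct (Nat.lt_ge_cases j q) as [Hjq|Hjq].
    + rewrite (Hfirst j Hjq). unfold Rdiv. ring.
    + assert (Hlj : lam q <= lam j).
      { destruct (Nat.eq_dec q j) as [->|]; [lra|]. apply Rlt_le, Hlam. lia. }
      rewrite pow_div_distr. field. repeat split; try exact HAq; apply pow_nonzero; lra.
Qed.

(** Missing zeros can be added to a list at most n times. *)
Lemma complete_zero_list (f : R -> R) (n : nat) :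
  (forall L, NoDup L -> (forall x, In x L -> a < x < b /\ f x = 0) -> (length L <= n)%nat) ->
  exists L, NoDup L /\ forall x, In x L <-> a < x < b /\ f x = 0.
Proof.
  intros Hbd.
  assert (Hgrow : forall d L, (n - length L <= d)%nat -> NoDup L ->
            (forall x, In x L -> a < x < b /\ f x = 0) ->
            exists L', NoDup L' /\ forall x, In x L' <-> a < x < b /\ f x = 0).
  { induction d as [|d IH]; intros L Hd HL HLz;
      (destruct (classic (exists x, (a < x < b /\ f x = 0) /\ ~ In x L)) as [(x & Hx & Hnin)|Hno];
       [assert (HL' : NoDup (x :: L)) by (now constructor);
        assert (HLz' : forall y, In y (x :: L) -> a < y < b /\ f y = 0)
          by (intros y [<-|Hy]; [exact Hx|now apply HLz])
       |exists L; split; [exact HL|]; intros x; split; [apply HLz|];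
        intros Hx; apply NNPP; intros Hnin; apply Hno; now exists x]).
    - specialize (Hbd _ HL' HLz'). simpl in Hbd. lia.
    - apply (IH (x :: L)); auto. simpl. lia. }
  apply (Hgrow n nil); [lia|constructor|intros x []].
Qed.

Theorem comb_zero_count (A : nat -> R) (m n : nat) :
  (forall j, (j < m)%nat -> A j = 0) ->
  (exists j, (j <= n)%nat /\ A j <> 0) ->
  exists zeros, NoDup zeros /\
    (forall x, In x zeros <-> a < x < b /\ comb A v (S n) x = 0) /\
    (m <= length zeros <= n)%nat.
Proof.
  intros Hm (j & Hj & HA).
  assert (Hex : exists j, (j < S n)%nat /\ A j <> 0) by (exists j; split; [lia|exact HA]).
  destruct (first_nonzero A (S n) Hex) as (q1 & Hq1 & HA1 & Hfirst).
  destruct (last_nonzero A (S n) Hex) as (q2 & Hq2 & HA2 & Hlast).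
  assert (Hmax : forall L, NoDup L ->
            (forall x, In x L -> a < x < b /\ comb A v (S n) x = 0) -> (length L <= n)%nat).
  { intros L HL HLz. enough (length L <= q2)%nat by lia.
    apply (zeros_at_most A (S n)); auto. now apply list_has_zeros. }
  destruct (complete_zero_list _ n Hmax) as (zeros & Hnd & Hiff).
  exists zeros. split; [exact Hnd|]. split; [exact Hiff|]. split.
  - assert (Hleast := zeros_at_least A (S n) q1 Hq1 HA1 Hfirst).
    destruct (has_zeros_list _ _ Hleast) as (L & HL & Hlen & HLz).
    assert (Hmq : (m <= q1)%nat).
    { destruct (Nat.le_gt_cases m q1) as [|Hlt]; [assumption|]. now apply Hm in Hlt. }
    assert (length L <= length zeros)%nat; [|lia].
    apply NoDup_incl_length; [exact HL|]. intros x Hx. now apply Hiff, HLz.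
  - apply Hmax; [exact Hnd|]. intros x. apply Hiff.
Qed.

End Pruefer.

(** * From eigenfunctions to modes *)

Lemma D_in_slope (f df : R -> R) (a b x : R) :
  D_in f df (fun y => a <= y <= b) x <->
  forall eps, 0 < eps -> exists d, 0 < d /\
    forall y, a <= y <= b -> y <> x -> Rabs (y - x) < d ->
    Rabs ((f y - f x) / (y - x) - df x) < eps.
Proof.
  unfold D_in, limit1_in, limit_in, D_x. simpl. unfold Rdist.
  split; intros H eps He; destruct (H eps He) as (d & Hd & Hy); exists d; (split; [exact Hd|]).
  - intros y H1 H2 H3. apply Hy. auto.
  - intros y ((H1 & H2) & H3). now apply Hy.
Qed.

(** Difference quotients at x are values of df at points between, by the mean value
    theorem. *)
Lemma D_in_of_interior (f df : R -> R) (a b x : R) :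
  continuity f -> continuity df -> a <= x <= b ->
  (forall t, a < t < b -> is_derive f t (df t)) ->
  D_in f df (fun y => a <= y <= b) x.
Proof.
  intros Cf Cdf Hx Hd. apply D_in_slope. intros eps He.
  destruct (continuity_pt_eps df x (Cdf x) eps He) as (d & Hd0 & Hcl).
  exists d. split; [exact Hd0|]. intros y Hy Hyx Hdist.
  destruct (mvt_between f df x y) as (c & Hc & ->).
  - auto.
  - intros t Ht. apply Hd. revert Ht. unfold Rmin, Rmax. destruct (Rle_dec x y); lra.
  - intros t _. apply Cf.
  - apply Hcl. apply Rabs_def2 in Hdist. revert Hc. unfold Rmin, Rmax.
    destruct (Rle_dec x y); intros; apply Rabs_def1; lra.
Qed.

Lemma D_in_clamp_continuity (f df : R -> R) (a b : R) :
  a <= b ->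
  (forall x, a <= x <= b -> D_in f df (fun y => a <= y <= b) x) ->
  continuity (fun x => f (clamp a b x)).
Proof.
  intros Hab HD x0. apply continuity_pt_of_eps. intros eps He.
  assert (Hin := clamp_in a b x0 Hab). set (x := clamp a b x0) in *.
  destruct (proj1 (D_in_slope f df a b x) (HD x Hin) 1 Rlt_0_1) as (d & Hd & Hy).
  assert (Hb := Rabs_pos (df x)).
  exists (Rmin d (eps / (Rabs (df x) + 1))). split.
  { apply Rmin_glb_lt; [exact Hd|]. apply Rdiv_lt_0_compat; lra. }
  intros y0 Hy0.
  assert (Hl := clamp_lipschitz a b y0 x0 Hab). fold x in Hl.
  assert (Hin' := clamp_in a b y0 Hab). set (y := clamp a b y0) in *.
  assert (M1 := Rmin_l d (eps / (Rabs (df x) + 1))).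
  assert (M2 := Rmin_r d (eps / (Rabs (df x) + 1))).
  destruct (Req_dec y x) as [->|Hne]; [rewrite Rminus_diag, Rabs_R0; exact He|].
  specialize (Hy y Hin' Hne ltac:(lra)).
  replace (f y - f x) with (((f y - f x) / (y - x) - df x + df x) * (y - x)) by (field; lra).
  rewrite Rabs_mult.
  assert (T := Rabs_triang ((f y - f x) / (y - x) - df x) (df x)).
  assert (P : 0 < Rabs (y - x)) by (apply Rabs_pos_lt; lra).
  apply Rle_lt_trans with ((Rabs (df x) + 1) * Rabs (y - x)).
  - apply Rmult_le_compat_r; lra.
  - assert (Q : Rabs (y - x) < eps / (Rabs (df x) + 1)) by lra.
    apply (Rmult_lt_compat_l (Rabs (df x) + 1)) in Q; [|lra].
    replace ((Rabs (df x) + 1) * (eps / (Rabs (df x) + 1))) with eps in Q by (field; lra).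
    exact Q.
Qed.

Lemma D_in_interior (f df : R -> R) (a b x : R) :
  a < x < b -> D_in f df (fun y => a <= y <= b) x -> is_derive f x (df x).
Proof.
  intros Hx HD. apply is_derive_Reals. intros eps He.
  destruct (proj1 (D_in_slope f df a b x) HD eps He) as (d & Hd & Hy).
  assert (Hp : 0 < Rmin d (Rmin (x - a) (b - x))) by (repeat apply Rmin_glb_lt; lra).
  exists (mkposreal _ Hp). intros h Hh Hlt. simpl in Hlt.
  assert (M1 := Rmin_l d (Rmin (x - a) (b - x))). assert (M2 := Rmin_r d (Rmin (x - a) (b - x))).
  assert (M3 := Rmin_l (x - a) (b - x)). assert (M4 := Rmin_r (x - a) (b - x)).
  assert (Hh' := Rabs_def2 _ _ Hlt).
  specialize (Hy (x + h)). replace (x + h - x) with h in Hy by ring.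
  apply Hy; lra.
Qed.

Lemma smooth_on_continuity (a b x : R) (f : R -> R) :
  smooth_on a b f -> a < x < b -> continuity_pt f x.
Proof.
  intros Hs Hx. apply continuity_pt_filterlim, (ex_derive_continuous f x), (Hs 1%nat x Hx).
Qed.

Lemma positive_bounds (f : R -> R) (a b : R) :
  a <= b -> (forall x, a <= x <= b -> continuity_pt f x) ->
  (forall x, a <= x <= b -> 0 < f x) ->
  exists c C, 0 < c /\ forall x, a <= x <= b -> c <= f x <= C.
Proof.
  intros Hab Hc Hp.
  destruct (continuity_ab_min f a b Hab Hc) as (x1 & Hmin & Hx1).
  destruct (continuity_ab_maj f a b Hab Hc) as (x2 & Hmax & Hx2).
  exists (f x1), (f x2). split; [now apply Hp|]. intros x Hx. split; auto.
Qed.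

Lemma left_bc_angle (h : Rbar) :
  Rbar_le 0 h ->
  exists t, 0 <= t <= PI / 2 /\ forall v q, left_bc h v q <-> cos t * v = sin t * q.
Proof.
  intros Hh. assert (HP := PI_RGT_0). destruct h as [h| |]; simpl in Hh.
  - exists (PI / 2 - atan h).
    assert (A := atan_bound h).
    assert (A0 : 0 <= atan h).
    { rewrite <- atan_0. destruct Hh as [Hh| <-]; [apply Rlt_le, atan_increasing, Hh|lra]. }
    split; [lra|]. intros v q. rewrite cos_shift, sin_shift.
    destruct (sin_cos_atan h) as (Hc & ->). simpl. split; intros E.
    + replace q with (h * v) by lra. ring.
    + apply (Rmult_eq_reg_l (cos (atan h))); lra.
  - exists 0. split; [lra|]. intros v q. rewrite cos_0, sin_0. simpl. split; lra.
  - contradiction.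
Qed.

Lemma right_bc_angle (H : Rbar) :
  Rbar_le 0 H ->
  exists t, PI / 2 <= t <= PI /\ forall v q, right_bc H v q <-> cos t * v = sin t * q.
Proof.
  intros Hh. assert (HP := PI_RGT_0). destruct H as [h| |]; simpl in Hh.
  - exists (PI / 2 + atan h).
    assert (A := atan_bound h).
    assert (A0 : 0 <= atan h).
    { rewrite <- atan_0. destruct Hh as [Hh| <-]; [apply Rlt_le, atan_increasing, Hh|lra]. }
    split; [lra|]. intros v q.
    rewrite cos_plus, sin_plus, cos_PI2, sin_PI2.
    destruct (sin_cos_atan h) as (Hc & ->). simpl. split; intros E.
    + replace q with (- h * v) by lra. ring.
    + apply (Rmult_eq_reg_l (cos (atan h))); lra.
  - exists PI. split; [lra|]. intros v q. rewrite cos_PI, sin_PI. simpl. split; lra.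
  - contradiction.
Qed.

Section Translation.

Variables (a b gam del : R) (K G L : R -> R) (h H : Rbar).
Hypothesis Hab : a < b.
Hypothesis Kcont : forall x, a <= x <= b -> continuity_pt K x.
Hypothesis Kpos : forall x, a <= x <= b -> 0 < K x.
Hypothesis Hleft : forall v q, left_bc h v q <-> cos gam * v = sin gam * q.
Hypothesis Hright : forall v q, right_bc H v q <-> cos del * v = sin del * q.
Let k (x : R) : R := / K (clamp a b x).
Let g (x : R) : R := G (clamp a b x).
Let l (x : R) : R := L (clamp a b x).
Hypothesis gcont : continuity g.
Hypothesis lcont : continuity l.

Lemma k_continuity : continuity k.
Proof.
  intros x. apply (continuity_pt_inv (fun x => K (clamp a b x))).
  - apply (continuity_clamp a b K); [lra|exact Kcont].
  - apply Rgt_not_eq, Kpos, clamp_in. lra.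
Qed.

(** Inside ]a, b[ the bound comes from the equation; nothing is assumed about the
    continuity of V' at the end points.  But the one-sided derivative there is a limit
    of difference quotients, that is, of values of V' at interior points tending to
    the end point, so the Lipschitz bound extends. *)
Lemma flux_lipschitz_closed (q V' f : R -> R) (M : R) :
  (forall x, q x = K x * V' x) ->
  continuity f -> (forall x, a < x < b -> is_derive f x (V' x)) ->
  (forall x, a <= x <= b -> D_in f V' (fun y => a <= y <= b) x) ->
  (forall x y, a < x < b -> a < y < b -> Rabs (q x - q y) <= M * Rabs (x - y)) ->
  0 <= M ->
  forall x y, a <= x <= b -> a <= y <= b -> Rabs (q x - q y) <= M * Rabs (x - y).
Proof.
  intros Hq Cf Df HD HM HM0.
  assert (Hhalf : forall x y, a <= x <= b -> a < y < b -> x <> y ->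
            Rabs (q x - q y) <= M * Rabs (x - y)).
  { intros x y Hx Hy Hxy. apply le_epsilon. intros eps He.
    set (W := K x + 1 + Rabs (V' x)).
    assert (HW : 0 < W) by (assert (A := Rabs_pos (V' x)); assert (B := Kpos x Hx); unfold W; lra).
    set (e := Rmin 1 (eps / W)).
    assert (He0 : 0 < e) by (apply Rmin_glb_lt; [lra|apply Rdiv_lt_0_compat; assumption]).
    assert (He1 : e <= 1) by apply Rmin_l. assert (He2 : e <= eps / W) by apply Rmin_r.
    assert (HeW : e * W <= eps).
    { replace eps with (eps / W * W) by (field; lra). apply Rmult_le_compat_r; lra. }
    destruct (proj1 (D_in_slope f V' a b x) (HD x Hx) e He0) as (d1 & Hd1 & Hslope).
    destruct (continuity_pt_eps K x (Kcont x Hx) e He0) as (d2 & Hd2 & HKx).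
    assert (Hdist : 0 < Rabs (y - x)) by (apply Rabs_pos_lt; lra).
    set (d := Rmin d1 d2).
    assert (Hd : 0 < d) by (apply Rmin_glb_lt; assumption).
    assert (D1 : d <= d1) by apply Rmin_l. assert (D2 : d <= d2) by apply Rmin_r.
    (* A difference quotient towards a point z strictly between x and y that is
       close to x equals V' at some xi in between, and it is close to V' x. *)
    set (t := d / (2 * (d + Rabs (y - x)))).
    assert (Ht0 : 0 < t) by (apply Rdiv_lt_0_compat; lra).
    assert (Htv : t * (2 * (d + Rabs (y - x))) = d) by (unfold t; field; lra).
    assert (Ht1 : t < 1) by nra.
    assert (Htd : t * Rabs (y - x) < d) by nra.
    set (z := x + t * (y - x)).
    assert (Ez : z - x = t * (y - x)) by (unfold z; ring).
    assert (Hzd : Rabs (z - x) < d) by (rewrite Ez, Rabs_mult, (Rabs_pos_eq t); lra).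
    assert (Hbetween : (x < z < y) \/ (y < z < x)).
    { destruct (Rlt_le_dec x y); [left|right]; nra. }
    destruct (mvt_between f V' x z) as (xi & Hxi & Exi).
    { destruct Hbetween; lra. }
    { intros s. unfold Rmin, Rmax. destruct (Rle_dec x z); intros Hs; apply Df;
        destruct Hbetween; lra. }
    { intros; apply Cf. }
    assert (Hsl := Hslope z ltac:(destruct Hbetween; lra) ltac:(destruct Hbetween; lra) ltac:(lra)).
    rewrite Exi in Hsl.
    assert (Hxib : (x < xi < z) \/ (z < xi < x)).
    { revert Hxi. unfold Rmin, Rmax. destruct (Rle_dec x z); intros; [left|right]; lra. }
    assert (Hxid : Rabs (xi - x) < d2).
    { apply Rabs_def2 in Hzd. apply Rabs_def1; destruct Hxib; destruct Hbetween; lra. }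
    assert (HK := HKx xi Hxid).
    assert (Hin : a < xi < b) by (destruct Hxib; destruct Hbetween; lra).
    assert (A1 := HM xi y Hin Hy).
    assert (A2 : M * Rabs (xi - y) <= M * Rabs (x - y)).
    { apply Rmult_le_compat_l; [exact HM0|].
      unfold Rabs. destruct (Rcase_abs (xi - y)); destruct (Rcase_abs (x - y));
        destruct Hxib; destruct Hbetween; lra. }
    assert (A3 : Rabs (q x - q xi) <= e * W).
    { rewrite !Hq.
      replace (K x * V' x - K xi * V' xi)
        with (- (K xi * (V' xi - V' x) + (K xi - K x) * V' x)) by ring.
      rewrite Rabs_Ropp. eapply Rle_trans; [apply Rabs_triang|]. rewrite !Rabs_mult.
      assert (B := Rabs_pos (V' x)).
      assert (HKb : Rabs (K xi) <= K x + 1).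
      { apply Rabs_def2 in HK. apply Rabs_le_between. assert (B' := Kpos x Hx). lra. }
      assert (B1 : Rabs (K xi) * Rabs (V' xi - V' x) <= (K x + 1) * e)
        by (apply Rmult_le_compat; try apply Rabs_pos; lra).
      assert (B2 : Rabs (K xi - K x) * Rabs (V' x) <= e * Rabs (V' x))
        by (apply Rmult_le_compat_r; lra).
      unfold W. lra. }
    replace (q x - q y) with ((q x - q xi) + (q xi - q y)) by ring.
    eapply Rle_trans; [apply Rabs_triang|]. lra. }
  intros x y Hx Hy. destruct (Req_dec x y) as [->|Hxy].
  { rewrite !Rminus_diag, !Rabs_R0. lra. }
  set (z := (x + y) / 2).
  assert (Hz : a < z < b) by (unfold z; lra).
  assert (A := Hhalf x z Hx Hz ltac:(unfold z; lra)).
  assert (B := Hhalf y z Hy Hz ltac:(unfold z; lra)).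
  replace (x - z) with ((x - y) / 2) in A by (unfold z; field).
  replace (y - z) with (- ((x - y) / 2)) in B by (unfold z; field).
  rewrite Rabs_Ropp in B. unfold Rdiv in A, B.
  rewrite Rabs_mult, (Rabs_pos_eq (/ 2)) in A, B by lra.
  replace (q x - q y) with ((q x - q z) - (q y - q z)) by ring.
  eapply Rle_trans; [apply Rabs_triang|]. rewrite Rabs_Ropp. lra.
Qed.

Lemma mode_of_eigenfunction (r : R) (V : R -> R) :
  eigenfunction a b K G L h H r V ->
  exists p, mode a b gam k g l del r (fun x => V (clamp a b x)) p.
Proof.
  intros ((x0 & Hx0 & Hnz) & V' & HD & Hode & Hl & Hr).
  set (v := fun x => V (clamp a b x)).
  set (q := fun x => K x * V' x).
  assert (Cv : continuity v) by (apply (D_in_clamp_continuity V V'); [lra|exact HD]).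
  assert (Ev : forall x, a <= x <= b -> v x = V x) by (intros; unfold v; now rewrite clamp_id).
  assert (Dv : forall x, a < x < b -> is_derive v x (V' x)).
  { intros x Hx. apply is_derive_clamp; [exact Hx|].
    apply (D_in_interior V V' a b); [exact Hx|apply HD; lra]. }
  assert (HDv : forall x, a <= x <= b -> D_in v V' (fun y => a <= y <= b) x).
  { intros x Hx. apply D_in_slope. intros eps He.
    destruct (proj1 (D_in_slope V V' a b x) (HD x Hx) eps He) as (d & Hd & Hy).
    exists d. split; [exact Hd|]. intros y Hy1. rewrite !Ev by assumption. now apply Hy. }
  assert (Dq : forall x, a < x < b -> is_derive q x (- potential g l r x * v x)).
  { intros x Hx. destruct (Hode x Hx) as (Ex & E).
    evar_last; [apply (Derive_correct q x Ex)|].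
    change (Derive q x + (r * G x - L x) * V x = 0) in E.
    unfold potential, g, l, v. rewrite clamp_id by lra. lra. }
  assert (Cf : continuity (fun x => potential g l r x * v x)).
  { intros x. apply continuity_pt_mult; [|apply Cv]. apply potential_continuity; assumption. }
  destruct (continuous_bound a b Hab _ Cf) as (M & HM0 & HM).
  assert (Hlip : forall x y, a <= x <= b -> a <= y <= b -> Rabs (q x - q y) <= M * Rabs (x - y)).
  { apply (flux_lipschitz_closed q V' v M); auto.
    intros x y Hx Hy. destruct (Req_dec x y) as [->|Hxy].
    { rewrite !Rminus_diag, !Rabs_R0. lra. }
    destruct (mvt_between q (fun t => - potential g l r t * v t) y x) as (c & Hc & E).
    - auto.
    - intros t. unfold Rmin, Rmax. destruct (Rle_dec y x); intros Ht; apply Dq; lra.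
    - intros t. unfold Rmin, Rmax. intros Ht. eapply is_derive_continuity_pt, Dq.
      revert Ht. destruct (Rle_dec y x); intros Ht; lra.
    - assert (Hcin : a <= c <= b).
      { revert Hc. unfold Rmin, Rmax. destruct (Rle_dec y x); intros; lra. }
      replace (q x - q y) with ((- potential g l r c * v c) * (x - y))
        by (rewrite <- E; field; lra).
      rewrite Rabs_mult. apply Rmult_le_compat_r; [apply Rabs_pos|].
      rewrite Ropp_mult_distr_l_reverse, Rabs_Ropp. now apply HM. }
  exists (fun x => q (clamp a b x)).
  split; [|split; [|split]].
  - split; [exact Cv|]. split.
    + apply (lipschitz_clamp_continuity q a b M); auto. lra.
    + intros x Hx. split.
      * evar_last; [now apply Dv|]. unfold k, q. rewrite clamp_id by lra.
        field. apply Rgt_not_eq, Kpos. lra.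
      * now apply is_derive_clamp, Dq.
  - unfold left_cond. rewrite !Ev by lra. rewrite clamp_id by lra. now apply Hleft.
  - unfold right_cond. rewrite !Ev by lra. rewrite clamp_id by lra. now apply Hright.
  - exists x0. split; [exact Hx0|]. now rewrite Ev.
Qed.

(** [eigenvalue_index] needs this direction: the solutions it constructs have to be
    eigenfunctions in the original sense, with one-sided derivatives at the end points. *)
Lemma eigenvalue_of_mode (r : R) (v p : R -> R) :
  mode a b gam k g l del r v p -> eigenvalue a b K G L h H r.
Proof.
  intros ((Cv & Cp & Ds) & Hl & Hr & Hnz).
  assert (HKk : forall x, a <= x <= b -> K x * (k x * p x) = p x).
  { intros x Hx. unfold k. rewrite clamp_id by exact Hx. field. apply Rgt_not_eq, Kpos, Hx. }
  assert (Ck : continuity (fun x => k x * p x)).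
  { intros x. apply continuity_pt_mult; [apply k_continuity|apply Cp]. }
  exists v. split; [exact Hnz|]. exists (fun x => k x * p x). split; [|split; [|split]].
  - intros x Hx. apply D_in_of_interior; auto. intros t Ht. now apply Ds.
  - intros x Hx. destruct (Ds x Hx) as (_ & Dp).
    assert (D : is_derive (fun t => K t * (k t * p t)) x (- potential g l r x * v x)).
    { apply (is_derive_ext_loc p); [|exact Dp].
      apply (filter_imp (fun y => clamp a b y = y)); [|now apply locally_clamp_id].
      intros y Hy. symmetry. apply HKk. rewrite <- Hy. apply clamp_in. lra. }
    split; [now exists (- potential g l r x * v x)|].
    apply is_derive_unique in D. simpl in D |- *. rewrite D. unfold potential, g, l.
    rewrite clamp_id by lra. ring.
  - apply Hleft. rewrite HKk by lra. exact Hl.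
  - apply Hright. rewrite HKk by lra. exact Hr.
Qed.

End Translation.

(** * The zeros of Y *)

(** The indices are shifted by one, and the coefficients below m are zero. *)
Lemma sum_n_m_comb (A : nat -> R) (f : nat -> R -> R) (m n : nat) (x : R) :
  (1 <= m)%nat ->
  sum_n_m (fun j => A j * f j x) m n =
  comb (fun i => if Nat.leb m (S i) then A (S i) else 0) (fun i => f (S i)) n x.
Proof.
  intros Hm. induction n as [|n IH].
  - apply (@sum_n_m_zero R_AbelianMonoid). lia.
  - simpl comb. rewrite <- IH. destruct (Nat.leb_spec m (S n)) as [Hle|Hlt].
    + now rewrite (@sum_n_Sm R_AbelianMonoid).
    + rewrite !(@sum_n_m_zero R_AbelianMonoid) by lia. unfold zero; simpl. ring.
Qed.

Lemma nonzero_coefficient (A : nat -> R) (m n : nat) :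
  sum_n_m (fun j => A j ^ 2) m n <> 0 -> exists j, (m <= j <= n)%nat /\ A j <> 0.
Proof.
  intros HA. apply NNPP. intros Hno. apply HA.
  rewrite (@sum_n_m_ext_loc R_AbelianMonoid _ (fun _ => zero)).
  - apply (@sum_n_m_const_zero R_AbelianMonoid).
  - intros j Hj. destruct (Req_dec (A j) 0) as [->|Hne].
    + unfold zero; simpl. ring.
    + exfalso. apply Hno. now exists j.
Qed.

Theorem theorem1p4
    (alpha0 beta0 alpha beta : R) (K G L : R -> R) (h H : Rbar)
    (Halpha : alpha0 < alpha) (Hab : alpha < beta) (Hbeta : beta < beta0)
    (HKs : smooth_on alpha0 beta0 K) (HGs : smooth_on alpha0 beta0 G)
    (HLs : smooth_on alpha0 beta0 L)
    (HKp : positive_on alpha0 beta0 K) (HGp : positive_on alpha0 beta0 G)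
    (HLp : positive_on alpha0 beta0 L)
    (Hh : Rbar_le 0 h) (HH : Rbar_le 0 H)
    (rho : nat -> R) (V : nat -> R -> R)
    (Hrho : eigenvalue_sequence alpha beta K G L h H rho)
    (HV : forall j : nat, (1 <= j)%nat ->
            eigenfunction alpha beta K G L h H (rho j) (V j))
    (m n : nat) (Hm : (1 <= m)%nat) (Hmn : (m <= n)%nat)
    (A : nat -> R) (HA : sum_n_m (fun j => A j ^ 2) m n <> 0) :
  let Y := fun x : R => sum_n_m (fun j => A j * V j x) m n in
  exists zeros : list R,
    NoDup zeros /\
    (forall x : R, In x zeros <-> (alpha < x < beta /\ Y x = 0)) /\
    (m - 1 <= length zeros <= n - 1)%nat.
Proof.
  intros Y.
  set (a := alpha) in *. set (b := beta) in *.
  assert (Hle : a <= b) by lra.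
  assert (cont : forall f, smooth_on alpha0 beta0 f -> forall x, a <= x <= b -> continuity_pt f x).
  { intros f Hf x Hx. apply (smooth_on_continuity alpha0 beta0); [exact Hf|lra]. }
  assert (pos : forall f, positive_on alpha0 beta0 f -> forall x, a <= x <= b -> 0 < f x).
  { intros f Hf x Hx. apply Hf. lra. }
  assert (Kcont := cont K HKs). assert (Kpos := pos K HKp).
  destruct (left_bc_angle h Hh) as (gam & Hgam & Hleft).
  destruct (right_bc_angle H HH) as (del & Hdel & Hright).
  set (k := fun x => / K (clamp a b x)).
  set (g := fun x => G (clamp a b x)).
  set (l := fun x => L (clamp a b x)).
  assert (Ck : continuity k) by now apply k_continuity.
  assert (Cg : continuity g) by (apply (continuity_clamp a b G Hle), cont, HGs).
  assert (Cl : continuity l) by (apply (continuity_clamp a b L Hle), cont, HLs).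
  assert (bounds : exists c C, 0 < c /\ (forall x, c <= k x <= C) /\
                     (forall x, c <= g x <= C) /\ (forall x, c <= l x <= C)).
  { destruct (positive_bounds K a b Hle Kcont Kpos) as (c1 & C1 & P1 & B1).
    destruct (positive_bounds G a b Hle (cont G HGs) (pos G HGp)) as (c2 & C2 & P2 & B2).
    destruct (positive_bounds L a b Hle (cont L HLs) (pos L HLp)) as (c3 & C3 & P3 & B3).
    assert (Q1 : c1 <= C1) by (specialize (B1 a ltac:(lra)); lra).
    assert (Q2 : c2 <= C2) by (specialize (B2 a ltac:(lra)); lra).
    assert (Q3 : c3 <= C3) by (specialize (B3 a ltac:(lra)); lra).
    assert (I1 : 0 < / C1) by (apply Rinv_0_lt_compat; lra).
    assert (I2 : 0 < / c1) by (apply Rinv_0_lt_compat; lra).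
    exists (Rmin (/ C1) (Rmin c2 c3)), (/ c1 + C2 + C3).
    assert (M1 := Rmin_l (/ C1) (Rmin c2 c3)). assert (M2 := Rmin_r (/ C1) (Rmin c2 c3)).
    assert (M3 := Rmin_l c2 c3). assert (M4 := Rmin_r c2 c3).
    split; [repeat apply Rmin_glb_lt; lra|].
    split; [|split]; intros x; assert (Hx := clamp_in a b x Hle).
    - unfold k. specialize (B1 _ Hx).
      assert (J1 : / C1 <= / K (clamp a b x)) by (apply Rinv_le_contravar; lra).
      assert (J2 : / K (clamp a b x) <= / c1) by (apply Rinv_le_contravar; lra). lra.
    - unfold g. specialize (B2 _ Hx). lra.
    - unfold l. specialize (B3 _ Hx). lra. }
  destruct bounds as (c & C & cpos & kbd & gbd & lbd).
  destruct Hrho as (Hinc & Heig).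
  (* The general theory numbers eigenvalues from 0. *)
  set (ev := fun i => rho (S i)). set (v := fun i x => V (S i) (clamp a b x)).
  assert (Hp : forall i, exists p, mode a b gam k g l del (ev i) (v i) p).
  { intros i. apply (mode_of_eigenfunction a b gam del K G L h H); auto. apply HV. lia. }
  apply functional_choice in Hp as [p Hmodes].
  assert (Hev : forall i j, (i < j)%nat -> ev i < ev j) by (intros; apply Hinc; lia).
  assert (Hindex : forall j, theta a b gam k g l (ev j) b = del + INR j * PI).
  { apply (eigenvalue_index a b c C gam k g l) with (del := del); auto.
    intros r. split.
    - intros (v' & p' & Hm').
      destruct (proj1 (Heig r) (eigenvalue_of_mode a b gam del K G L h H Hab Kcont Kpos
                                  Hleft Hright r v' p' Hm')) as (j & Hj & ->).
      exists (j - 1)%nat. unfold ev. f_equal. lia.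
    - intros (j & ->). now exists (v j), (p j). }
  destruct (nonzero_coefficient A m n HA) as (j & Hj & HAj).
  destruct (comb_zero_count a b c C gam k g l Hab Ck Cg Cl cpos kbd gbd lbd del Hgam Hdel
              ev v p Hev Hmodes Hindex
              (fun i => if Nat.leb m (S i) then A (S i) else 0) (m - 1) (n - 1))
    as (zeros & Hnd & Hiff & Hlen).
  - intros i Hi. destruct (Nat.leb_spec m (S i)); [lia|reflexivity].
  - exists (j - 1)%nat. split; [lia|]. replace (S (j - 1)) with j by lia.
    destruct (Nat.leb_spec m j); [exact HAj|lia].
  - exists zeros. split; [exact Hnd|]. split; [|exact Hlen].
    intros x. rewrite Hiff. replace (S (n - 1)) with n by lia.
    assert (E : forall x, a < x < b ->
              comb (fun i => if Nat.leb m (S i) then A (S i) else 0) v n x = Y x).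
    { intros y Hy. unfold Y. rewrite sum_n_m_comb by exact Hm.
      clear - Hy. induction n as [|n IH]; [reflexivity|]. simpl. rewrite IH.
      unfold v. rewrite clamp_id by lra. reflexivity. }
    split; intros (Hx & Ex); (split; [exact Hx|]); [rewrite <- E|rewrite E]; assumption.
Qed.
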